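(* Let $P$ be a simple polytope, $\mathcal{W}$ a facoidal system of walks in $G(P)$, and $\mathcal{O}$ an acyclic orientation of $G(P)$. Then $$\#\mathcal{W}\le f_2(P)\le \mathcal{H}_2(\mathcal{O}).$$ Moreover: (1) the first inequality holds with equality if and only if $\mathcal{W}=\mathcal{F}_2(P)$; (2) the second inequality holds with equality if and only if $\mathcal{O}$ is an AOF-orientation of $G(P)$.
   Context: A $d$-polytope $P$ is simple if every vertex lies in exactly $d$ facets; $G(P)=(V(P),E(P))$ is its graph; $f_2(P)$ is the number of $2$-faces of $P$. For an orientation $\mathcal{O}$, $h_k(\mathcal{O})$ is the number of nodes of in-degree $k$, and $\mathcal{H}_2(\mathcal{O})=\sum_{k=0}^d h_k(\mathcal{O})\binom{k}{2}$. A closed smooth walk is a sequence $(w_0,\dots,w_{l-1})$, $l\ge3$, of nodes with $\{w_i,w_{i+1}\}\in E(P)$ and $w_{i-1}\ne w_{i+1}$ for all $i$ (indices mod $l$), identified up to cyclic shift and reversal. A facoidal system of walks is a set $\mathcal{W}$ of closed smooth walks such that for every node $v$ and neighbors $v_1\neq v_2$ of $v$ there is a unique walk in $\mathcal{W}$ and a unique position $i$ in it with $(w_{i-1},w_i,w_{i+1})\in\{(v_1,v,v_2),(v_2,v,v_1)\}$. $\mathcal{F}_2(P)$ denotes the facoidal system consisting of the boundary cycles of the $2$-faces of $P$ (each $2$-face as a closed smooth walk). A bijection $\varphi:V(P)\to\{1,\dots,|V(P)|\}$ induces the orientation directing each edge from larger to smaller $\varphi$-value; it is an abstract objective function if this orientation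 has a unique sink in every non-empty face of $P$ (including $P$), and such orientations are AOF-orientations. *)

(* Defs.v *)
From HB Require Import structures.
From mathcomp Require Import all_boot all_order all_algebra.
From mathcomp Require Import finmap.
From mathcomp Require Import boolp classical_sets functions cardinality reals.

Set Implicit Arguments.
Unset Strict Implicit.
Unset Printing Implicit Defensive.

Import Order.TTheory GRing.Theory Num.Theory.

Local Open Scope classical_set_scope.
Local Open Scope ring_scope.

(* Number of elements of a finite set. An infinite set gets the value 0, but
   every set counted below is finite when P is a polytope, and so is a
   facoidal system, in which distinct walks use distinct triples of nodes. *)
Definition ncard (T : choiceType) (A : set T) : nat := #|` fset_set A|.

Section Polytopes.
Variables (R : realType) (n : nat).
Implicit Types (A F P : set 'rV[R]_n) (u v x : 'rV[R]_n) (k d : nat).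

Definition conv_hull A : set 'rV[R]_n :=
  [set x | exists m (p : 'I_m -> 'rV[R]_n) (a : 'I_m -> R),
     [/\ forall i, A (p i), forall i, 0 <= a i,
         \sum_i a i = 1 & x = \sum_i a i *: p i]].

Definition aff_hull A : set 'rV[R]_n :=
  [set x | exists m (p : 'I_m -> 'rV[R]_n) (a : 'I_m -> R),
     [/\ forall i, A (p i), \sum_i a i = 1 & x = \sum_i a i *: p i]].

(* The affine hull of A is a translate of a k-dimensional linear subspace; no
   k : nat satisfies this for the empty set, whose dimension is -1. *)
Definition has_dim A k : Prop :=
  exists (x0 : 'rV[R]_n) (U : {vspace 'rV[R]_n}),
    \dim U = k /\ aff_hull A = [set x | x - x0 \in U].

Definition polytope P : Prop :=
  exists s : seq 'rV[R]_n, P = conv_hull [set` s].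

(* c = 0 gives the two improper faces: P itself (b = 0) and set0 (b = 1). *)
Definition face P F : Prop :=
  exists (c : 'cV[R]_n) (b : R),
    (forall x, P x -> (x *m c) 0 0 <= b) /\
    F = [set x | P x /\ (x *m c) 0 0 = b].

Definition kface P k : set (set 'rV[R]_n) :=
  [set F | face P F /\ has_dim F k].

Definition vertices P : set 'rV[R]_n := [set v | face P [set v]].

Definition edge P u v : Prop :=
  [/\ vertices P u, vertices P v, u <> v & face P (conv_hull [set u; v])].

Definition simple P d : Prop :=
  has_dim P d /\
  forall v, vertices P v ->
    ncard [set F | (exists2 k, d = k.+1 & kface P k F) /\ F v] = d.

Definition f_ k P : nat := ncard (kface P k).

End Polytopes.

Section CyclicSequences.
Variable T : choiceType.

Definition dihedral_rel (s t : seq T) : bool :=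
  `[< exists k, s = rot k t \/ s = rot k (rev t) >].

Let rot_rev k (s : seq T) : exists j, rev (rot k s) = rot j (rev s).
Proof.
have [le_sk | lt_ks] := leqP (size s) k.
  by exists 0%N; rewrite rot_oversize ?rot0.
exists (size s - k)%N; rewrite /rot rev_cat drop_rev take_rev.
by rewrite subKn // ltnW.
Qed.

Let rot_rot k j (s : seq T) : exists i, rot k (rot j s) = rot i s.
Proof.
have [le_sk | lt_ks] := leqP (size s) k.
  by exists j; rewrite rot_oversize ?size_rot.
have [le_sj | lt_js] := leqP (size s) j.
  by exists k; rewrite (rot_oversize le_sj).
exists (if (k + j <= size s) then k + j else k + j - size s)%N.
by rewrite rot_add_mod // ltnW.
Qed.

Lemma dihedral_rel_refl : reflexive dihedral_rel.
Proof. by move=> s; apply/asboolP; exists 0%N; left; rewrite rot0. Qed.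

Lemma dihedral_rel_sym : symmetric dihedral_rel.
Proof.
suff imp s t : dihedral_rel s t -> dihedral_rel t s.
  by move=> s t; apply/idP/idP; apply: imp.
move=> /asboolP [k [->|->]]; apply/asboolP.
- by exists (size (rot k t) - k)%N; left; rewrite -[LHS](rotK k).
- have [j Ej] := rot_rev k (rev t).
  rewrite revK in Ej.
  exists (size (rot j t) - j)%N; right.
  by rewrite Ej -[LHS](rotK j).
Qed.

Lemma dihedral_rel_trans : transitive dihedral_rel.
Proof.
move=> t s u /asboolP [k Hk] /asboolP [j Hj]; apply/asboolP.
case: Hk Hj => -> [->|->].
- by have [i ->] := rot_rot k j u; exists i; left.
- by have [i ->] := rot_rot k j (rev u); exists i; right.
- have [i ->] := rot_rev j u; have [l ->] := rot_rot k i (rev u).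
  by exists l; right.
- have [i ->] := rot_rev j (rev u); rewrite revK.
  by have [l ->] := rot_rot k i u; exists l; left.
Qed.

Canonical dihedral_equiv :=
  EquivRel dihedral_rel dihedral_rel_refl dihedral_rel_sym dihedral_rel_trans.

(* Sequences up to cyclic shift and reversal. *)
Definition cyc_seq := {eq_quot dihedral_equiv}%qT.

End CyclicSequences.

Section Walks.
Variables (R : realType) (n : nat).
Implicit Types (P F : set 'rV[R]_n) (w : seq 'rV[R]_n) (v : 'rV[R]_n).

(* The node of w at position i, read modulo the length of w; the predecessor
   of position i is position i + (l - 1). *)
Definition at_pos w i : 'rV[R]_n := nth 0 w (i %% size w).
Definition prev_pos w i : 'rV[R]_n := at_pos w (i + (size w).-1).
Definition next_pos w i : 'rV[R]_n := at_pos w i.+1.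

Definition closed_smooth_walk P w : Prop :=
  (3 <= size w)%N /\
  forall i, (i < size w)%N ->
    edge P (at_pos w i) (next_pos w i) /\ prev_pos w i <> next_pos w i.

Definition passes w i v1 v v2 : Prop :=
  (i < size w)%N /\
  ((prev_pos w i, at_pos w i, next_pos w i) = (v1, v, v2) \/
   (prev_pos w i, at_pos w i, next_pos w i) = (v2, v, v1)).

(* Smoothness and the number of positions at which a walk passes through
   v1, v, v2 do not depend on the representative. The uniqueness below is that
   of the pair (walk, position). *)
Definition facoidal P (W : set (cyc_seq 'rV[R]_n)) : Prop :=
  (forall C, W C -> closed_smooth_walk P (repr C)) /\
  forall v v1 v2, edge P v v1 -> edge P v v2 -> v1 <> v2 ->
    exists! Ci : cyc_seq 'rV[R]_n * nat,
      W Ci.1 /\ passes (repr Ci.1) Ci.2 v1 v v2.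

(* The boundary cycle of a 2-face F: w visits each vertex of F exactly once,
   and moves along edges (an edge of P joining two vertices of F is an edge of
   F, so this is the cyclic order of the vertices along the polygon F). *)
Definition boundary_cycle P F w : Prop :=
  [/\ (3 <= size w)%N, uniq w, forall v, (v \in w) <-> (vertices P v /\ F v) &
      forall i, (i < size w)%N -> edge P (at_pos w i) (next_pos w i)].

Definition F2 P : set (cyc_seq 'rV[R]_n) :=
  [set C | exists2 F, kface P 2 F &
     exists2 w, boundary_cycle P F w & C = \pi_(cyc_seq 'rV[R]_n)%qT w].

End Walks.

Section Orientations.
Variables (R : realType) (n : nat).
Implicit Types (P F : set 'rV[R]_n) (O : rel 'rV[R]_n) (v : 'rV[R]_n).

(* O u v means that the edge {u, v} is directed from u to v. *)
Definition orientation P O : Prop :=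
  (forall u v, O u v -> edge P u v) /\
  (forall u v, edge P u v -> O u v (+) O v u).

Definition acyclic O : Prop :=
  forall w : seq 'rV[R]_n, w != [::] -> ~~ cycle O w.

Definition indegree O v : nat := ncard [set u | O u v].

Definition h_ k P O : nat := ncard [set v | vertices P v /\ indegree O v = k].

Definition H2 P d O : nat := (\sum_(k < d.+1) h_ k P O * 'C(k, 2))%N.

Definition is_sink O F v : Prop := F v /\ forall u, F u -> ~~ O v u.

Definition numbering P (phi : 'rV[R]_n -> nat) : Prop :=
  set_bij (vertices P) [set k | (1 <= k <= ncard (vertices P))%N] phi.

Definition induced_orientation P (phi : 'rV[R]_n -> nat) : rel 'rV[R]_n :=
  fun u v => `[< edge P u v >] && (phi v < phi u)%N.

Definition abstract_objective_function P (phi : 'rV[R]_n -> nat) : Prop :=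
  numbering P phi /\
  forall F, face P F -> F !=set0 ->
    exists! v, vertices P v /\ is_sink (induced_orientation P phi) F v.

Definition AOF_orientation P O : Prop :=
  exists2 phi, abstract_objective_function P phi &
    forall u v, O u v = induced_orientation P phi u v.

End Orientations.

(* Main.v *)
(** Every face of a simple polytope containing a vertex v is spanned by a set of
    edges at v, so that pairs of edges at v correspond to 2-faces at v, and a
    vertex of a face G whose neighbors in G do not improve a linear functional
    is optimal on G.

    Let O be an orientation in which every 2-face has a sink. Counting the pairs
    of edges that enter a common vertex, first by vertices and then by the
    2-faces they span, shows that H_2(O) is the sum over the 2-faces of their
    numbers of sinks. For a facoidal system W the same pairs are counted by the
    positions at which the walks of W have a sink, and every walk has one. For
    a generic linear functional every face has exactly one sink, whence
    #W <= f_2 <= H_2(O), with equality on the right iff O has unique sinks in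
    all 2-faces.

    If O is acyclic and has unique sinks in 2-faces, then every vertex of a face
    G reaches exactly one sink of G: two out-neighbors of v lie with v in a
    2-face, whose sink is reachable from both. The reached sink is constant
    along edges and G is connected, so G has only one sink.

    If #W = f_2, every walk has exactly one sink for every generic functional.
    For a functional that is larger on the 2-face F than elsewhere, the walk
    through the sink of F must stay in F, hence it is the boundary of F. *)
Require Import Defs.
From mathcomp Require Import all_boot all_order all_algebra.
From mathcomp Require Import finmap.
From mathcomp Require Import boolp classical_sets functions cardinality reals.
From mathcomp Require Import lra zify.

Set Implicit Arguments.
Unset Strict Implicit.
Unset Printing Implicit Defensive.

Import Order.TTheory GRing.Theory Num.Theory.

(** * Linear functionals, the Farkas lemma and separation *)

Section Functionals.
Local Open Scope ring_scope.
Variables (R : realFieldType) (n : nat).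
Implicit Types (c e : 'cV[R]_n) (x y : 'rV[R]_n).

Definition ev c x : R := (x *m c) 0 0.

Lemma evD c x y : ev c (x + y) = ev c x + ev c y.
Proof. by rewrite /ev mulmxDl mxE. Qed.

Lemma evB c x y : ev c (x - y) = ev c x - ev c y.
Proof. by rewrite /ev mulmxBl !mxE. Qed.

Lemma evN c x : ev c (- x) = - ev c x.
Proof. by rewrite /ev mulNmx !mxE. Qed.

Lemma evZ c k x : ev c (k *: x) = k * ev c x.
Proof. by rewrite /ev -scalemxAl mxE. Qed.

Lemma ev0 c : ev c 0 = 0.
Proof. by rewrite /ev mul0mx mxE. Qed.

Lemma ev_sum c (I : Type) (r : seq I) (Q : pred I) (f : I -> 'rV[R]_n) :
  ev c (\sum_(i <- r | Q i) f i) = \sum_(i <- r | Q i) ev c (f i).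
Proof. by rewrite /ev mulmx_suml summxE. Qed.

Lemma evDl c e x : ev (c + e) x = ev c x + ev e x.
Proof. by rewrite /ev mulmxDr mxE. Qed.

Lemma evNl c x : ev (- c) x = - ev c x.
Proof. by rewrite /ev mulmxN mxE. Qed.

Lemma evZl k c x : ev (k *: c) x = k * ev c x.
Proof. by rewrite /ev -scalemxAr mxE. Qed.

Lemma ev_suml (I : Type) (r : seq I) (Q : pred I) (f : I -> 'cV[R]_n) x :
  ev (\sum_(i <- r | Q i) f i) x = \sum_(i <- r | Q i) ev (f i) x.
Proof. by rewrite /ev mulmx_sumr summxE. Qed.

Lemma ev_tr x : (ev x^T x == 0) = (x == 0).
Proof.
rewrite /ev mxE psumr_eq0; last by move=> i _; rewrite mxE -expr2 sqr_ge0.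
apply/allP/eqP => [x0|-> i _]; last by rewrite mxE mul0r eqxx.
apply/rowP => i; have := x0 i (mem_index_enum _).
by rewrite mxE -expr2 sqrf_eq0 mxE => /eqP.
Qed.

(** Each strict inequality leaves room for a small step in the direction [e], and finitely many
    rooms have a positive minimum. *)
Lemma perturb (E : seq 'rV[R]_n) c e : exists2 t, 0 < t &
  forall x, x \in E -> 0 < ev c x -> 0 < ev (c + t *: e) x.
Proof.
elim: E => [|y E [t t0 IH]]; first by exists 1.
have [y0|y0] := ltP 0 (ev c y); last first.
  by exists t => // x; rewrite inE => /orP[/eqP->|/IH//]; rewrite ltNge y0.
have [u u0 uy] : exists2 u, 0 < u & forall s, 0 < s <= u -> 0 < ev (c + s *: e) y.
  (* The summand 1 keeps the denominator positive and the result strict: for [s] up to this bound,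
     [s * ev e y] is at most [ev c y - s] in absolute value. *)
  exists (ev c y / (1 + `|ev e y|)).
    by rewrite divr_gt0 // ltr_pwDl.
  move=> s /andP[s0 su]; rewrite evDl evZl.
  have H : 0 < 1 + `|ev e y| by rewrite ltr_pwDl.
  have : s * (1 + `|ev e y|) <= ev c y by rewrite -ler_pdivlMr.
  have : - (s * ev e y) <= s * `|ev e y|.
    by rewrite -mulrN ler_wpM2l ?(ltW s0) // -normrN ler_norm.
  by rewrite mulrDr; lra.
exists (Num.min t u); first by rewrite lt_min t0.
move=> x; rewrite inE => /orP[/eqP-> _|xE cx].
  by apply: uy; rewrite lt_min t0 u0 /= ge_min lexx orbT.
have := IH x xE cx; rewrite !evDl !evZl => H.
have [e0|e0] := leP 0 (ev e x).
  by apply: ltr_pwDl => //; rewrite mulr_ge0 // le_min !ltW.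
apply: lt_le_trans H _; rewrite lerD2l.
by apply: ler_wnM2r; rewrite ?ge_min ?lexx // ltW.
Qed.

(** The points of [D] are treated one by one. If [c] vanishes at [x], a small multiple of [x^T] is
    added, whose value at [x] is the squared norm. *)
Lemma generic_functional (D E : seq 'rV[R]_n) c : 0 \notin D ->
  exists c', (forall x, x \in D -> ev c' x != 0) /\
    (forall x, x \in E -> 0 < ev c x -> 0 < ev c' x).
Proof.
elim: D E c => [|x D IH] E c; first by move=> _; exists c.
rewrite inE negb_or eq_sym => /andP[x0 D0].
have [c1 c1x c1E] : exists2 c1, ev c1 x != 0 &
    forall y, y \in E -> 0 < ev c y -> 0 < ev c1 y.
  have [cx|cx] := eqVneq (ev c x) 0; last by exists c.
  have [t t0 tE] := perturb E c x^T.
  exists (c + t *: x^T) => //; rewrite evDl evZl cx add0r.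
  by rewrite mulf_neq0 ?ev_tr // gt_eqF.
(* [x] and [- x] join the list of preserved inequalities, so later perturbations cannot make the
   value at [x] vanish again. *)
have [c' [c'D c'E]] := IH (x :: - x :: E) c1 D0.
exists c'; split => [y|y yE cy]; last first.
  by apply: c'E; rewrite ?inE ?yE ?orbT //; apply: c1E.
rewrite inE => /orP[/eqP->|/c'D//].
have [c1x0|c1x0|/eqP] := ltgtP (ev c1 x) 0; last by rewrite (negbTE c1x).
  have : 0 < ev c' (- x) by apply: c'E; rewrite ?inE ?eqxx ?orbT // evN oppr_gt0.
  by rewrite evN oppr_gt0 => /lt_eqF->.
have : 0 < ev c' x by apply: c'E; rewrite ?inE ?eqxx.
by move=> /gt_eqF->.
Qed.

(* Bartl's induction: either the first generator is redundant for the
   hypothesis, or a violating functional c0 splits off the first generator. *)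
Lemma farkas m (a : 'I_m -> 'rV[R]_n) b :
  (forall c, (forall i, ev c (a i) <= 0) -> ev c b <= 0) ->
  exists l : 'I_m -> R, (forall i, 0 <= l i) /\ b = \sum_i l i *: a i.
Proof.
elim: m a b => [|m IH] a b H.
  exists (fun=> 0); split => //; rewrite big_ord0; apply/eqP; rewrite -ev_tr.
  have H1 := H b^T (fun i => False_ind _ (notF (ltn_ord i))).
  have := H (- b^T) (fun i => False_ind _ (notF (ltn_ord i))).
  by rewrite evNl oppr_le0 => H2; rewrite eq_le H1 H2.
pose a' i := a (lift ord0 i).
have [H'|] := pselect (forall c, (forall i, ev c (a' i) <= 0) -> ev c b <= 0).
  have [l [l0 ->]] := IH a' b H'.
  exists (fun i => oapp l 0 (unlift ord0 i)); split => [i|].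
    by case: (unliftP ord0 i) => [j|] _ /=.
  rewrite big_ord_recl unlift_none /= scale0r add0r.
  by apply: eq_bigr => i _; rewrite liftK.
move=> /existsNP[c1 /not_implyP[c1a' /negP]]; rewrite -ltNge => c1b.
have c1a : 0 < ev c1 (a ord0).
  rewrite ltNge; apply/negP => c1a0; move: c1b; rewrite ltNge => /negP; apply.
  by apply: H => i; case: (unliftP ord0 i) => [j|] -> //; apply: c1a'.
pose c0 := (ev c1 (a ord0))^-1 *: c1.
have c0a' i : ev c0 (a' i) <= 0.
  by rewrite evZl pmulr_rle0 ?invr_gt0.
have c0b : 0 < ev c0 b by rewrite evZl pmulr_rgt0 ?invr_gt0.
have c0a : ev c0 (a ord0) = 1 by rewrite evZl mulVf ?gt_eqF.
clearbody c0.
have [|l [l0 lb]] := IH (fun i => a' i - ev c0 (a' i) *: a ord0)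
                        (b - ev c0 b *: a ord0).
  move=> c Hc; pose c' := c - ev c (a ord0) *: c0.
  have E x : ev c (x - ev c0 x *: a ord0) = ev c' x.
    by rewrite evB evZ /c' evDl evNl evZl mulrC.
  rewrite E; apply: H => i; case: (unliftP ord0 i) => [j|] ->.
    by rewrite -E; apply: Hc.
  by rewrite /c' evDl evNl evZl c0a mulr1 subrr.
(* The coefficient of the first generator is nonnegative since [c0] is positive at [b] and
   nonpositive at the other generators. *)
exists (fun i => oapp l (ev c0 b - \sum_i l i * ev c0 (a' i)) (unlift ord0 i)).
split => [i|].
  case: (unliftP ord0 i) => [j|] _ //=; rewrite subr_ge0; apply: le_trans (ltW c0b).
  by apply: sumr_le0 => j _; rewrite mulr_ge0_le0.
rewrite big_ord_recl unlift_none /=.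
under [X in _ + X]eq_bigr do rewrite liftK /=.
move/eqP: lb; rewrite subr_eq => /eqP lb; rewrite [LHS]lb /=.
under eq_bigr do rewrite scalerBr.
rewrite sumrB scalerBl addrAC [RHS]addrC addrA; congr (_ - _).
by rewrite scaler_suml; apply: eq_bigr => i _; rewrite scalerA.
Qed.

(** Farkas for the vectors of [s] together with their negatives: the cone they generate is the span,
    and a functional nonpositive on both signs vanishes on it. *)
Lemma separate_point (s : seq 'rV[R]_n) b : b \notin <<s>>%VS ->
  exists2 c, (forall x, x \in <<s>>%VS -> ev c x = 0) & 0 < ev c b.
Proof.
move=> bs; pose a (i : 'I_(size s + size s)) : 'rV[R]_n :=
  match fintype.split i with inl j => s`_j | inr j => - s`_j end.
have [H|] := pselect (forall c, (forall i, ev c (a i) <= 0) -> ev c b <= 0).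
  have [l [_ bE]] := farkas H; case/negP: bs; rewrite bE.
  apply: memv_suml => i _; apply: memvZ; rewrite /a.
  by case: fintype.split => j; rewrite ?memvN memv_span // mem_nth.
move=> /existsNP[c /not_implyP[ca /negP]]; rewrite -ltNge => cb.
exists c => // x xs.
rewrite (coord_span (X := in_tuple s) xs) ev_sum big1 // => i _; rewrite evZ /=.
have := ca (unsplit (inl i)); have := ca (unsplit (inr i)).
rewrite /a !unsplitK evN oppr_le0 => H1 H2.
by rewrite (_ : ev c s`_i = 0) ?mulr0 //; apply/eqP; rewrite eq_le H1 H2.
Qed.

Definition tight m (a : 'I_m -> 'rV[R]_n) c : seq 'rV[R]_n :=
  [seq a i | i <- enum 'I_m & ev c (a i) == 0].

Lemma tightP m (a : 'I_m -> 'rV[R]_n) c x :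
  reflect (exists2 i, ev c (a i) = 0 & x = a i) (x \in tight a c).
Proof.
apply: (iffP mapP) => [[i]|[i ci ->]].
  by rewrite mem_filter => /andP[/eqP ci _] ->; exists i.
by exists i; rewrite // mem_filter mem_enum ci eqxx.
Qed.

(** A separating functional is tilted until its tight generators span a hyperplane of the whole
    span. Each tilt goes in a direction [e] that vanishes at [b] and on the tight generators, so the
    separation is kept while the tight span grows. *)
Lemma separating_facet m (a : 'I_m -> 'rV[R]_n) b :
    b \in <<[seq a i | i <- enum 'I_m]>>%VS ->
    (forall l : 'I_m -> R, (forall i, 0 <= l i) -> b <> \sum_i l i *: a i) ->
  exists c, [/\ forall i, ev c (a i) <= 0, 0 < ev c b &
    \dim <<[seq a i | i <- enum 'I_m]>> =
    (\dim <<tight a c>>).+1].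
Proof.
set L := <<_>>%VS => bL bN.
pose T c := <<tight a c>>%VS.
have TP c x : x \in T c -> ev c x = 0.
  move=> xT; rewrite (coord_span (X := in_tuple _) xT) ev_sum big1 // => i _.
  rewrite evZ /= (_ : ev c _ = 0) ?mulr0 //.
  by have /tightP[j cj ->] : (tight a c)`_i \in tight a c by apply: mem_nth.
have TL c : (T c <= L)%VS.
  apply: sub_span => x /tightP[i _ ->]; apply: map_f; exact: mem_enum.
have [c0 [c0a c0b]] : exists c, (forall i, ev c (a i) <= 0) /\ 0 < ev c b.
  apply: contrapT => H; have [c ca|l [l0]] := @farkas m a b; last exact: bN.
  by rewrite leNgt; apply/negP => cb; apply: H; exists c.
have [k] := ubnP (\dim L - \dim (T c0)).
elim: k c0 c0a c0b => // k IH c ca cb.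
have bT : b \notin T c by apply/negP => /TP; lra.
have TLlt : (\dim (T c) < \dim L)%N.
  rewrite ltn_neqAle dimvS // andbT; apply/negP => /eqP E.
  have /eqP TE : T c == L by rewrite eqEdim TL E leqnn.
  by rewrite TE bL in bT.
have [LT _|/subvPn[y yL]] := boolP (L <= T c + <[b]>)%VS.
  exists c; split=> //; apply/eqP; rewrite eqn_leq TLlt andbT.
  apply: leq_trans (dimvS LT) _; apply: leq_trans (dimv_add_leqif _ _) _.
  by rewrite dim_vline -[X in (_ <= X)%N]addn1 leq_add2l leq_b1.
move=> yT Hk.
have [e eT [i0 ei0]] : exists2 e, (forall x, x \in (T c + <[b]>)%VS -> ev e x = 0)
    & exists i, 0 < ev e (a i).
  have TE : (T c + <[b]> = <<(vbasis (T c)) ++ [:: b]>>)%VS.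
    by rewrite span_cat (span_basis (vbasisP _)) span_seq1.
  rewrite TE in yT *.
  have [e e0 ey] := separate_point yT.
  (* [e] is nonzero at [y], hence at some generator; if it is positive at none, [- e] is positive at
     one. *)
  have [[i ei]|/forallNP H] := pselect (exists i, 0 < ev e (a i)).
    by exists e => //; exists i.
  exists (- e) => [x /e0|]; first by rewrite evNl => ->; rewrite oppr0.
  apply: contrapT => /forallNP H'; move: ey.
  rewrite (coord_span (X := in_tuple _) yL) ev_sum big1 ?ltxx // => i _.
  rewrite evZ /= (_ : ev e _ = 0) ?mulr0 //.
  have : nth 0 [seq a i | i <- enum 'I_m] i \in [seq a i | i <- enum 'I_m].
    by apply: mem_nth.
  case/mapP => j _ ->; apply/eqP; rewrite eq_le leNgt; apply/andP; split.
    by apply/negP/H.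
  by rewrite -oppr_le0 -evNl leNgt; apply/negP/H'.
have eT' x : x \in T c -> ev e x = 0.
  by move=> xT; apply: eT; apply: (subvP (addvSl _ _)).
have eb : ev e b = 0 by apply: eT; apply: (subvP (addvSr _ _)); rewrite memv_line.
(* [q i] is the step along [e] at which generator [i] becomes tight. The smallest such step keeps
   every generator on the nonpositive side. *)
pose q i := - ev c (a i) / ev e (a i).
case: (arg_minP q (i0 := i0) (P := fun i => 0 < ev e (a i)) ei0) => i1 ei1 i1min.
pose c' := c + q i1 *: e.
have q0 : 0 <= q i1 by rewrite /q divr_ge0 ?oppr_ge0 ?(ltW ei1).
have c'a i : ev c' (a i) <= 0.
  rewrite evDl evZl; have [ei|ei] := ltP 0 (ev e (a i)).
    have := i1min i ei; rewrite {2}/q ler_pdivlMr //; lra.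
  have := ca i; have : q i1 * ev e (a i) <= 0 by rewrite mulr_ge0_le0.
  lra.
have c'b : 0 < ev c' b by rewrite evDl evZl eb mulr0 addr0.
apply: (IH c') => //.
suff : (\dim (T c) < \dim (T c'))%N by move: Hk TLlt; lia.
have TS : (T c <= T c')%VS.
  apply: sub_span => x /tightP[i ci ->]; apply/tightP; exists i => //.
  rewrite evDl evZl ci add0r eT' ?mulr0 //.
  by apply: memv_span; apply/tightP; exists i.
have i1T' : a i1 \in T c'.
  apply: memv_span; apply/tightP; exists i1 => //; rewrite evDl evZl.
  by rewrite /q divfK ?subrr // gt_eqF.
rewrite ltn_neqAle dimvS // andbT; apply/negP => /eqP E.
have /eqP TE : T c == T c' by rewrite eqEdim TS E leqnn.
by move: i1T' ei1; rewrite -TE => /eT' ->; rewrite ltxx.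
Qed.

End Functionals.

(** * Faces of polytopes *)

Lemma seq_argmax disp (D : orderType disp) (T : eqType) (s : seq T) (f : T -> D) x0 :
  x0 \in s -> exists2 x, x \in s & forall y, y \in s -> (f y <= f x)%O.
Proof.
elim: s x0 => // a [|b s] IH x0 _.
  by exists a; rewrite ?mem_head // => y; rewrite inE => /eqP ->.
have [x xs xmax] := IH b (mem_head _ _).
have [ax|/ltW xa] := leP (f a) (f x).
  exists x; first by rewrite inE xs orbT.
  by move=> y; rewrite inE => /orP[/eqP ->|/xmax].
exists a; first by rewrite mem_head.
move=> y; rewrite inE => /orP[/eqP ->|/xmax yx]; first exact: lexx.
exact: le_trans yx xa.
Qed.

Lemma ncardE (T : choiceType) (A : set T) (s : seq T) :
  uniq s -> (forall x, A x <-> x \in s) -> ncard A = size s.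
Proof.
move=> us As; rewrite /ncard.
have -> : A = [set` s]%classic.
  by apply/seteqP; split => x /=; [move/(As x).1|move/(As x).2].
apply/perm_size/uniq_perm => // x.
by rewrite in_fset_set //; apply/idP/idP; rewrite inE.
Qed.

Lemma finite_enum (T : choiceType) (A : set T) : finite_set A ->
  exists2 s : seq T, uniq s & forall x, A x <-> x \in s.
Proof.
move=> fA; exists (fset_set A); first exact: fset_uniq.
by move=> x; rewrite in_fset_set // inE.
Qed.

Section Polytope.
Local Open Scope ring_scope.
Local Open Scope classical_set_scope.
Variables (R : realType) (n : nat).
Implicit Types (A P F G : set 'rV[R]_n) (c e : 'cV[R]_n) (x y v : 'rV[R]_n).

Lemma sub_conv_hull A x : A x -> conv_hull A x.
Proof.
move=> Ax; exists 1%N, (fun=> x), (fun=> 1); split => //.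
  by rewrite big_ord1.
by rewrite big_ord1 scale1r.
Qed.

Lemma sub_aff_hull A x : A x -> aff_hull A x.
Proof.
move=> Ax; exists 1%N, (fun=> x), (fun=> 1); split => //.
  by rewrite big_ord1.
by rewrite big_ord1 scale1r.
Qed.

Lemma conv_hull_mono A B x : A `<=` B -> conv_hull A x -> conv_hull B x.
Proof. by move=> AB [m [p [a [pA a0 a1 xE]]]]; exists m, p, a; split => // i; apply: AB. Qed.

Lemma conv_hull_inhabited A x : conv_hull A x -> A !=set0.
Proof.
move=> [[|m] [p [a [pA _ a1 _]]]]; last by exists (p ord0).
by move: a1 => /eqP; rewrite big_ord0 eq_sym oner_eq0.
Qed.

Lemma conv_hull_le A c b x : (forall p, A p -> ev c p <= b) ->
  conv_hull A x -> ev c x <= b.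
Proof.
move=> Ab [m [p [a [pA a0 a1 ->]]]]; rewrite ev_sum -[b]mul1r -a1 mulr_suml.
by apply: ler_sum => i _; rewrite evZ ler_wpM2l // Ab.
Qed.

Lemma conv_hull_eq A c b x : (forall p, A p -> ev c p = b) ->
  conv_hull A x -> ev c x = b.
Proof.
move=> Ab [m [p [a [pA a0 a1 ->]]]]; rewrite ev_sum -[b]mul1r -a1 mulr_suml.
by apply: eq_bigr => i _; rewrite evZ Ab.
Qed.

(** A weighted mean of numbers at most [b] equals [b] only if every point of nonzero weight attains
    [b]. *)
Lemma conv_hull_face A c b x : (forall p, A p -> ev c p <= b) ->
  conv_hull A x -> ev c x = b -> conv_hull [set p | A p /\ ev c p = b] x.
Proof.
move=> Ab [m [p [a [pA a0 a1 xE]]]] cx.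
have tight i : a i != 0 -> ev c (p i) = b.
  move=> ai; have : \sum_j a j * (b - ev c (p j)) == 0.
    under eq_bigr do rewrite mulrBr.
    rewrite sumrB -mulr_suml a1 mul1r subr_eq0 -[X in X == _]cx xE ev_sum.
    by apply/eqP; apply: eq_bigr => j _; rewrite evZ.
  rewrite psumr_eq0 => [/allP/(_ i (mem_index_enum _))|j _]; last first.
    by rewrite mulr_ge0 // subr_ge0 Ab.
  by rewrite mulf_eq0 (negbTE ai) subr_eq0 => /eqP.
have [i0 ai0] : exists i0, a i0 != 0.
  apply: contrapT => /forallNP H; move/eqP: a1.
  by rewrite big1 ?(eq_sym 0) ?oner_eq0 // => i _; apply/eqP/negPn/negP/H.
(* Points of weight 0 may miss the face; they are replaced by [p i0], which has nonzero weight. *)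
exists m, (fun i => if a i == 0 then p i0 else p i), a; split => //.
  move=> i; case: ifPn => [_|/tight ci]; split => //; exact: tight.
rewrite xE; apply: eq_bigr => i _; case: ifPn => // /eqP ->.
by rewrite !scale0r.
Qed.

Lemma sub_spanP (X : seq 'rV[R]_n) (W : {vspace 'rV[R]_n}) :
  (forall x, x \in X -> x \in W) -> (<<X>> <= W)%VS.
Proof. by move=> XW; apply/span_subvP. Qed.

Lemma aff_hull_sub A v (W : {vspace 'rV[R]_n}) x :
  (forall y, A y -> y - v \in W) -> aff_hull A x -> x - v \in W.
Proof.
move=> AW [m [p [a [pA a1 ->]]]].
rewrite -[v]scale1r -a1 scaler_suml -sumrB; apply: memv_suml => i _.
by rewrite -scalerBr memvZ // AW.
Qed.

(** Any point of [A] can serve as base point. The direction space is then the least subspace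
    containing all differences from it, a description free of affine combinations. *)
Lemma has_dim_direction A k v : has_dim A k -> A v ->
  exists U : {vspace 'rV[R]_n}, [/\ \dim U = k, forall x, A x -> x - v \in U &
    forall W : {vspace 'rV[R]_n}, (forall x, A x -> x - v \in W) -> (U <= W)%VS].
Proof.
move=> [x0 [U [dU AU]]] Av.
have AE x : aff_hull A x <-> x - x0 \in U by rewrite AU.
have vU : v - x0 \in U by apply/AE/sub_aff_hull.
exists U; split => //.
  move=> x /sub_aff_hull/AE xU.
  have -> : x - v = (x - x0) - (v - x0) by rewrite opprB addrA subrK.
  exact: memvB.
move=> W AW; apply/subvP => u uU.
have /(aff_hull_sub AW) : aff_hull A (v + u) by apply/AE; rewrite addrAC memvD.
by rewrite addrC addKr.
Qed.

Lemma has_dim_span A v (X : seq 'rV[R]_n) : A v ->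
  (forall y, y \in X -> A (v + y)) -> (forall x, A x -> x - v \in <<X>>%VS) ->
  has_dim A (\dim <<X>>).
Proof.
move=> Av XA AX; exists v, <<X>>%VS; split => //; apply/seteqP; split => x /=.
  exact: aff_hull_sub.
move=> xX; pose t i := coord (in_tuple X) i (x - v).
(* The weight left over by the coordinates of [x - v] goes to [v], so that the weights sum to 1. *)
exists (size X).+1, (fun i => oapp (fun j : 'I_(size X) => v + X`_j) v (unlift ord0 i)),
  (fun i => oapp t (1 - \sum_j t j) (unlift ord0 i)); split.
- by move=> i; case: (unliftP ord0 i) => [j|] _ //=; apply: XA; apply: mem_nth.
- rewrite big_ord_recl unlift_none /=.
  under [X in _ + X]eq_bigr do rewrite liftK /=.
  by rewrite subrK.
rewrite big_ord_recl unlift_none /=.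
under [X in _ + X]eq_bigr do rewrite liftK /= scalerDr.
rewrite big_split /= -scaler_suml addrA -scalerDl subrK scale1r.
rewrite -{1}(subrK v x) addrC; congr (_ + _).
exact: (coord_span (X := in_tuple X) xX).
Qed.

Lemma has_dim_unique A k k' : A !=set0 -> has_dim A k -> has_dim A k' -> k = k'.
Proof.
move=> [v Av] Hk Hk'.
have [U [<- AU Umin]] := has_dim_direction Hk Av.
have [U' [<- AU' U'min]] := has_dim_direction Hk' Av.
by congr (\dim _); apply/eqP; rewrite eqEsubv Umin // U'min.
Qed.

Lemma has_dim_inhabited A k : has_dim A k -> A !=set0.
Proof.
move=> [x0 [U [_ AU]]].
have [[|m] [p [a [pA a1 _]]]] : aff_hull A x0 by rewrite AU /= subrr mem0v.
  by move: a1 => /eqP; rewrite big_ord0 eq_sym oner_eq0.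
by exists (p ord0).
Qed.

Variables (s : seq 'rV[R]_n).
Let P := conv_hull [set` s].

Lemma faceP F : face P F <-> exists c b,
  (forall x, P x -> ev c x <= b) /\ F = [set x | P x /\ ev c x = b].
Proof. by []. Qed.

Lemma mem_polytope x : x \in s -> P x.
Proof. exact: sub_conv_hull. Qed.

Lemma face_sub F x : face P F -> F x -> P x.
Proof. by move=> [c [b [_ ->]]] []. Qed.

Lemma face_conv_hull F : face P F -> F = conv_hull [set x | x \in s /\ F x].
Proof.
move=> /faceP[c [b [Pb FE]]]; apply/seteqP; split => x.
  rewrite {1}FE => -[Px cx].
  apply: conv_hull_mono (conv_hull_face _ Px cx).
    by move=> p [/= ps cp]; split => //; rewrite FE; split => //; apply: mem_polytope.
  by move=> p /mem_polytope/Pb.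
move=> Fx; rewrite FE; split; first by apply: conv_hull_mono Fx => p [].
by apply: conv_hull_eq Fx => p [_]; rewrite FE => -[].
Qed.



Lemma face_inhabited F : face P F -> F !=set0 -> exists2 x, x \in s & F x.
Proof.
by move=> fF [x]; rewrite {1}(face_conv_hull fF) => /conv_hull_inhabited[y []]; exists y.
Qed.

Lemma vertex_mem v : vertices P v -> v \in s.
Proof. by move=> /face_inhabited[|x xs <-] //; exists v. Qed.

(** A face is the hull of the generators it contains, so bit masks on [s] cover all faces. *)
Lemma finite_faces : finite_set (face P).
Proof.
apply: (@sub_finite_set _ _ ((fun m : (size s).-tuple bool =>
  conv_hull [set` mask m s]) @` setT)); last exact: finite_image.
move=> F fF; exists [tuple of [seq `[<F x>] | x <- in_tuple s]] => //=.
rewrite [RHS](face_conv_hull fF); congr conv_hull; apply/seteqP; split => x /=;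
  rewrite -filter_mask mem_filter.
  by move=> /andP[/asboolP Fx xs].
by move=> [xs Fx]; rewrite xs andbT; apply/asboolP.
Qed.

(** The maximizers of [e] on [F] are exposed in [P] by [c + t *: e], where [c] exposes [F] and [t]
    is so small that no generator outside [F] catches up with [x0]. *)
Lemma face_max F e : face P F -> F !=set0 -> exists b x0,
  [/\ F x0, ev e x0 = b, forall x, F x -> ev e x <= b &
      face P [set x | F x /\ ev e x = b]].
Proof.
move=> fF F0; have [y ys Fy] := face_inhabited fF F0.
have [|x0] := seq_argmax (ev e) (x0 := y) (s := [seq x <- s | `[<F x>]]).
  by rewrite mem_filter ys andbT; apply/asboolP.
rewrite mem_filter => /andP[/asboolP Fx0 x0s] x0max.
have emax x : F x -> ev e x <= ev e x0.
  rewrite {1}(face_conv_hull fF); apply: conv_hull_le => p [ps Fp].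
  by apply: x0max; rewrite mem_filter ps andbT; apply/asboolP.
exists (ev e x0), x0; split => //.
have /faceP[c [b [Pb FE]]] := fF.
have [t t0 tE] := perturb [seq x0 - p | p <- s] c e.
have FP x : F x <-> P x /\ ev c x = b by rewrite FE.
have cx0 : ev c x0 = b by case/FP : Fx0.
have sle p : p \in s -> ev (c + t *: e) p <= ev (c + t *: e) x0 /\
    (ev (c + t *: e) p = ev (c + t *: e) x0 -> F p).
  move=> ps; have := Pb p (mem_polytope ps); rewrite le_eqVlt => /orP[/eqP cp|cp].
    have Fp : F p by apply/FP; split => //; apply: mem_polytope.
    by split => //; rewrite !evDl !evZl cp cx0 lerD2l ler_wpM2l ?emax // ltW.
  have : 0 < ev (c + t *: e) (x0 - p).
    by apply: tE; [exact: map_f|rewrite evB cx0 subr_gt0].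
  by rewrite evB subr_gt0 => lt_p; split; [exact: ltW|move=> E; rewrite E ltxx in lt_p].
apply/faceP; exists (c + t *: e), (ev (c + t *: e) x0); split.
  by move=> x Px; apply: conv_hull_le Px => p /sle[].
apply/seteqP; split => x /=.
  move=> [Fx ex]; split; first exact: face_sub Fx.
  by case/FP: Fx => _ cx; rewrite !evDl !evZl cx cx0 ex.
move=> [Px cx]; have Fx : F x.
  rewrite (face_conv_hull fF); apply: conv_hull_mono (conv_hull_face _ Px cx).
    by move=> p /= [ps /(sle p ps).2].
  by move=> p /sle[].
split => //; case/FP: Fx => _ cx'; move/eqP: cx.
rewrite !evDl !evZl cx' cx0 => /eqP/addrI/(mulfI _)-> //.
by rewrite gt_eqF.
Qed.

Lemma generic_on_seq c : exists h,
  (forall x y, x \in s -> y \in s -> x <> y -> ev h x <> ev h y) /\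
  (forall x y, x \in s -> y \in s -> ev c x < ev c y -> ev h x < ev h y).
Proof.
pose D := [seq x - y | x <- s, y <- s].
have memD x y : x \in s -> y \in s -> x - y \in D.
  by move=> xs ys; apply/allpairsP; exists (x, y).
have [|h [h0 hc]] := @generic_functional R n [seq x <- D | x != 0] D c.
  by rewrite mem_filter eqxx.
exists h; split => x y xs ys.
  move=> /eqP xy hxy; have := h0 (x - y).
  by rewrite mem_filter memD // subr_eq0 xy evB hxy subrr eqxx => /(_ isT).
move=> cxy; have := hc (y - x) (memD _ _ ys xs).
by rewrite !evB !subr_gt0 => /(_ cxy).
Qed.

(** A functional that is injective on the generators is maximal on [F] at one generator only, and
    the hull of a single point is that point. *)
Lemma face_vertex F : face P F -> F !=set0 -> exists2 v, vertices P v & F v.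
Proof.
move=> fF F0; have [h [hinj _]] := generic_on_seq 0.
have [b [x0 [Fx0 hx0 _ fG]]] := face_max h fF F0.
have [|y ys [Fy hy]] := face_inhabited fG; first by exists x0.
exists y => //; rewrite /vertices /= (_ : [set y] = [set x | F x /\ ev h x = b]) //.
apply/seteqP; split; first by move=> _ ->.
move=> x; rewrite (face_conv_hull fG) => Gx.
have Hy z : z \in s /\ [set x | F x /\ ev h x = b] z -> z = y.
  by move=> [zs [_ hz]]; apply: contrapT => /(hinj _ _ zs ys); rewrite hz hy.
apply/rowP => i; pose c : 'cV[R]_n := delta_mx i 0.
have cE z : ev c z = z 0 i by rewrite /ev -colE mxE.
by rewrite -!cE; apply: conv_hull_eq Gx => p /Hy ->.
Qed.
End Polytope.

(** * The tangent cone at a vertex of a simple polytope *)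

Lemma ncard_enum (T : choiceType) (A : set T) d : finite_set A -> ncard A = d ->
  exists F : 'I_d -> T, forall x, A x <-> exists i, F i = x.
Proof.
move=> fA <-; have [s us sE] := finite_enum fA; rewrite (ncardE us sE).
exists (fun i => tnth (in_tuple s) i) => x; split.
  by move=> /sE/(tnthP (in_tuple s))[i ->]; exists i.
by move=> [i <-]; apply/sE/mem_tnth.
Qed.

Lemma row_free_inj (F : fieldType) m k (A : 'M[F]_(m, k)) :
  (forall x : 'rV_m, x *m A = 0 -> x = 0)%R -> row_free A.
Proof.
move=> H; rewrite -kermx_eq0; apply/rowV0P => x /sub_kermxP; exact: H.
Qed.

Section TangentCone.
Local Open Scope ring_scope.
Local Open Scope classical_set_scope.
Variables (R : realType) (n : nat) (s : seq 'rV[R]_n) (d : nat) (v : 'rV[R]_n).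
Let P := conv_hull [set` s].
Hypothesis simpleP : simple P d.
Hypothesis vertexv : vertices P v.

Let a (i : 'I_(size s)) : 'rV[R]_n := s`_i - v.
Let X := [seq a i | i <- enum 'I_(size s)].

Let Pv : P v.
Proof. exact: (face_sub vertexv). Qed.



Let mem_a (i : 'I_(size s)) : s`_i \in s.
Proof. by rewrite mem_nth. Qed.

Let memX x : x \in s -> x - v \in X.
Proof.
move=> xs; apply/mapP; have xi : (index x s < size s)%N by rewrite index_mem.
by exists (Ordinal xi); rewrite ?mem_enum // /a /= nth_index.
Qed.

Let P_span x : P x -> x - v \in <<X>>%VS.
Proof.
move=> Px; apply: (@aff_hull_sub _ _ [set` s]).
  by move=> y /memX/memv_span.
by case: Px => m [p [t [pA t0 t1 xE]]]; exists m, p, t.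
Qed.

Let dimL : d = \dim <<X>>.
Proof.
apply: (has_dim_unique _ simpleP.1); first by exists v.
apply: (@has_dim_span _ _ P v) => // y /mapP[i _ ->].
by rewrite /a addrC subrK; apply: mem_polytope.
Qed.



Let aX i : a i \in <<X>>%VS.
Proof. by apply/memv_span/map_f; rewrite mem_enum. Qed.

(** Simplicity supplies exactly [d] facets at [v]. Each is exposed by a functional, which is
    nonpositive on [P] seen from [v]. *)
Lemma facet_functionals : exists cc : 'I_d -> 'cV[R]_n,
  [/\ forall i x, P x -> ev (cc i) (x - v) <= 0,
      forall i, exists2 x, P x & ev (cc i) (x - v) < 0 &
      forall G k, d = k.+1 -> kface P k G -> G v ->
        exists i, G = [set x | P x /\ ev (cc i) (x - v) = 0]].
Proof.
have fin : finite_set [set F | (exists2 k, d = k.+1 & kface P k F) /\ F v].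
  by apply: sub_finite_set (@finite_faces _ _ s) => F /= [[k _ []]].
have [F FE] := ncard_enum fin (simpleP.2 v vertexv).
have H i : exists c : 'cV[R]_n, [/\ forall x, P x -> ev c (x - v) <= 0,
    exists2 x, P x & ev c (x - v) < 0 & F i = [set x | P x /\ ev c (x - v) = 0]].
  have [[k dk [fF dF]] Fv] := (FE (F i)).2 (ex_intro _ i erefl).
  have /faceP[c [b [Pb FiE]]] := fF; exists c.
  have cv : ev c v = b by move: Fv; rewrite FiE => -[].
  have FiE' : F i = [set x | P x /\ ev c (x - v) = 0].
    rewrite FiE; apply/seteqP; split => x /= [Px cx]; split => //.
      by rewrite evB cx cv subrr.
    by move: cx; rewrite evB cv => /eqP; rewrite subr_eq0 => /eqP.
  split => // [x /Pb|]; first by rewrite evB cv subr_le0.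
  (* A functional that is nowhere negative would make the facet equal to [P], whose dimension is one
     larger. *)
  apply: contrapT => /forall2NP N.
  have FP : F i = P.
    rewrite FiE; apply/seteqP; split => x; [by case|move=> Px; split => //].
    case: (N x) => // /negP; rewrite evB cv subr_lt0 -leNgt => cx.
    by apply/eqP; rewrite eq_le cx Pb.
  move: dF; rewrite FP => dP; have := has_dim_unique (ex_intro _ v Pv) dP simpleP.1.
  by rewrite dk => /n_Sn.
have [cc ccP] := choice H; exists cc; split.
- by move=> i; case: (ccP i).
- by move=> i; case: (ccP i).
move=> G k dk kG Gv.
have [|i <-] := (FE G).1 _; first by split => //; exists k.
by exists i; case: (ccP i).
Qed.

(* If y were outside of the cone, a facet separating it from the cone would be
   one of the facets at v, whose functional is nonpositive on y. *)
Lemma cone_facets (cc : 'I_d -> 'cV[R]_n) :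
    (forall i x, P x -> ev (cc i) (x - v) <= 0) ->
    (forall i, exists2 x, P x & ev (cc i) (x - v) < 0) ->
    (forall G k, d = k.+1 -> kface P k G -> G v ->
      exists i, G = [set x | P x /\ ev (cc i) (x - v) = 0]) ->
  forall y, y \in <<X>>%VS -> (forall i, ev (cc i) y <= 0) ->
  exists l : 'I_(size s) -> R, (forall i, 0 <= l i) /\ y = \sum_i l i *: a i.
Proof.
move=> ccP ccN ccF y yL ycc; apply: contrapT => /forallNP N.
have [|c [ca cy dimT]] := separating_facet yL.
  by move=> l l0 yl; apply: (N l).
have aE i : ev c (a i) = ev c s`_i - ev c v by rewrite evB.
pose G := [set x | P x /\ ev c x = ev c v].
have sle p : p \in s -> ev c p <= ev c v.
  move=> ps; rewrite -subr_le0 -evB.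
  by have /mapP[i _ ->] := memX ps.
have fG : face P G.
  by apply/faceP; exists c, (ev c v); split => // x; apply: conv_hull_le.
have Gv : G v by [].
have GT y' : y' \in tight a c -> G (v + y').
  move=> /tightP[i ci ->]; rewrite /a addrC subrK; split; first exact: mem_polytope.
  by apply/eqP; rewrite -subr_eq0 -aE ci.
have TG x : G x -> x - v \in <<tight a c>>%VS.
  move=> [Px cx]; apply: (@aff_hull_sub _ _ [set p | p \in s /\ ev c p = ev c v]).
    move=> p [/= ps cp]; have /mapP[i _ E] := memX ps; rewrite E.
    by apply/memv_span/tightP; exists i => //; rewrite -E evB cp subrr.
  have [m [p [t [pA _ t1 xE]]]] := conv_hull_face sle Px cx.
  by exists m, p, t; split => // i; have [] := pA i.
(* The tight generators span a hyperplane of [<<X>>], so [G] is a facet through [v] and occurs in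
   the list. *)
have [i GE] := ccF G _ (etrans dimL dimT) (conj fG (has_dim_span Gv GT TG)) Gv.
have iT t : t \in <<tight a c>>%VS -> ev (cc i) t = 0.
  move=> tT; rewrite (coord_span (X := in_tuple _) tT) ev_sum big1 // => j _.
  rewrite evZ /= (_ : ev (cc i) _ = 0) ?mulr0 //.
  have /GT : (tight a c)`_j \in tight a c by apply: mem_nth.
  by rewrite GE => -[_]; rewrite addrC addKr.
have cT t : t \in <<tight a c>>%VS -> ev c t = 0.
  move=> tT; rewrite (coord_span (X := in_tuple _) tT) ev_sum big1 // => j _.
  rewrite evZ /= (_ : ev c _ = 0) ?mulr0 //.
  by have /tightP[k ck ->] : (tight a c)`_j \in tight a c by apply: mem_nth.
have yT : y \notin <<tight a c>>%VS by apply/negP => /cT; lra.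
have TyL : (<<tight a c>> + <[y]>)%VS = <<X>>%VS.
  apply/eqP; rewrite eqEdim; apply/andP; split.
    rewrite subv_add -memvE yL andbT.
    by apply: sub_spanP => x /tightP[k _ ->].
  have yT0 : (<<tight a c>> :&: <[y]> = 0)%VS.
    apply/eqP; rewrite -subv0; apply/subvP => z /memv_capP[zT /vlineP[k zk]].
    rewrite memv0 zk scaler_eq0; apply/orP; left; apply: contraT => k0.
    have := memvZ k^-1 zT.
    by rewrite zk scalerA mulVf // scale1r (negbTE yT).
  rewrite dimT dimv_disjoint_sum // dim_vline (_ : y != 0) ?addn1 //.
  by apply: contraNneq yT => ->; rewrite mem0v.
have [x Px] := ccN i; apply/negP; rewrite -leNgt.
(* Modulo the tight span, [a j] is [k *: y]. Since [c] is positive at [y], it forces [k <= 0]; then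
   [cc i] is nonnegative at [a j], hence 0 there, and so 0 on all of [P], against [ccN]. *)
suff H j : ev (cc i) (a j) = 0.
  have -> // : ev (cc i) (x - v) = 0.
  rewrite evB (conv_hull_eq (b := ev (cc i) v) _ Px) ?subrr // => p ps.
  have /mapP[j _ /(congr1 (ev (cc i)))] := memX ps.
  by rewrite H evB => /eqP; rewrite subr_eq0 => /eqP.
have : a j \in (<<tight a c>> + <[y]>)%VS by rewrite TyL.
move=> /memv_addP[t tT [_ /vlineP[k ->] aj]].
have k0 : k <= 0.
  by have := ca j; rewrite aj evD cT // add0r evZ pmulr_lle0.
apply/eqP; rewrite eq_le; apply/andP; split.
  by apply: ccP; apply: mem_polytope.
by rewrite aj evD iT // add0r evZ mulr_le0.
Qed.

(** The tangent cone is pointed because [v] is a vertex, so the [d] facet functionals are injective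
    on its [d]-dimensional span. Hence they are coordinates, up to sign, in which the cone is the
    nonnegative orthant, and [r] is the dual basis. *)
Lemma tangent_cone_orthant : exists (c : 'I_d -> 'cV[R]_n) (r : 'I_d -> 'rV[R]_n),
  [/\ forall x i, P x -> 0 <= ev (c i) (x - v),
      forall x, P x -> x - v = \sum_i ev (c i) (x - v) *: r i,
      forall i j, ev (c i) (r j) = (i == j)%:R &
      forall i, exists u k, [/\ 0 < k, P u & u - v = k *: r i]].
Proof.
have [cc [ccP ccN ccF]] := facet_functionals.
have key := cone_facets ccP ccN ccF.
have [c0 [b0 [Pb0 vE]]] := (faceP _ _).1 vertexv.
have [_ c0v] : P v /\ ev c0 v = b0 by rewrite -[_ /\ _]/([set x | P x /\ ev c0 x = b0] v) -vE.
have a_neg i : ev c0 (a i) <= 0.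
  by rewrite evB c0v subr_le0; apply: Pb0; apply: mem_polytope.
have a_eq0 i : ev c0 (a i) = 0 -> a i = 0.
  move=> /eqP; rewrite evB c0v subr_eq0 => /eqP E.
  have : [set v] s`_i by rewrite vE; split => //; apply: mem_polytope.
  by rewrite /a => ->; rewrite subrr.
(* If all facet functionals vanish at [y], both [y] and [- y] lie in the cone. Then [c0], which
   exposes [v], vanishes at [y], and this kills every term of the combination. *)
have inj y : y \in <<X>>%VS -> (forall i, ev (cc i) y = 0) -> y = 0.
  move=> yL y0.
  have [|l [l0 yE]] := key y yL; first by move=> i; rewrite y0.
  have [||l' [l'0 y'E]] := key (- y); first by rewrite memvN.
    by move=> i; rewrite evN y0 oppr0.
  have c0y : ev c0 y = 0.
    apply/eqP; rewrite eq_le; apply/andP; split.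
      by rewrite yE ev_sum sumr_le0 // => i _; rewrite evZ mulr_ge0_le0.
    rewrite -oppr_le0 -evN y'E ev_sum sumr_le0 // => i _.
    by rewrite evZ mulr_ge0_le0.
  rewrite yE big1 // => i _.
  have : \sum_i - ev c0 (l i *: a i) == 0 by rewrite sumrN -ev_sum -yE c0y oppr0.
  rewrite psumr_eq0 => [/allP/(_ i (mem_index_enum _))|j _]; last first.
    by rewrite oppr_ge0 evZ mulr_ge0_le0.
  rewrite oppr_eq0 evZ mulf_eq0 => /orP[/eqP ->|/eqP/a_eq0 ->].
    by rewrite scale0r.
  by rewrite scaler0.
(* The sign makes the coordinates nonnegative on the cone. *)
pose M : 'M[R]_(n, d) := \matrix_(k, i) - cc i k 0.
have ME y i : (y *m M) 0 i = - ev (cc i) y.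
  by rewrite /ev !mxE -sumrN; apply: eq_bigr => k _; rewrite !mxE mulrN.
pose B : 'M[R]_(d, n) := \matrix_i (vbasis <<X>>)`_i.
have BL (x : 'rV_d) : x *m B \in <<X>>%VS.
  rewrite mulmx_sum_row; apply: memv_suml => i _; rewrite rowK memvZ //.
  by apply/vbasis_mem/mem_nth; rewrite size_tuple -dimL.
have B_inj (x : 'rV_d) : x *m B = 0 -> x = 0.
  rewrite mulmx_sum_row => xB; apply/rowP => i; rewrite mxE.
  have /freeP fr : free (vbasis <<X>>) by apply: basis_free (vbasisP _).
  have := fr (fun j => x 0 (cast_ord (esym dimL) j)) _ (cast_ord dimL i).
  rewrite cast_ordK; apply.
  rewrite -[RHS]xB (reindex (cast_ord dimL)) /=; last first.
    by exists (cast_ord (esym dimL)) => j _; rewrite ?cast_ordK ?cast_ordKV.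
  by apply: eq_bigr => j _; rewrite cast_ordK rowK.
have BM_unit : B *m M \in unitmx.
  rewrite -row_free_unit; apply: row_free_inj => x; rewrite mulmxA => xBM.
  apply/B_inj/inj => // i; apply/eqP; rewrite -oppr_eq0 -ME xBM mxE //.
(* The rows of [Q] lie in the span and are dual to the columns of [M]; they become the rays. *)
pose Q := invmx (B *m M) *m B.
have QM : Q *m M = 1%:M by rewrite -mulmxA mulVmx.
have QL (x : 'rV_d) : x *m Q \in <<X>>%VS by rewrite mulmxA.
have LQ y : y \in <<X>>%VS -> y = y *m M *m Q.
  move=> yL; apply/eqP; rewrite -subr_eq0; apply/eqP; apply: inj => [|i].
    by rewrite memvB.
  apply/eqP; rewrite -oppr_eq0 -ME mulmxBl -[X in _ - X]mulmxA QM mulmx1 subrr mxE //.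
pose r i := row i Q.
have rE i j : ev (- cc i) (r j) = (i == j)%:R.
  have -> : ev (- cc i) (r j) = row j (Q *m M) 0 i by rewrite evNl -ME row_mul.
  by rewrite QM !mxE eq_sym.
have LE y : y \in <<X>>%VS -> y = \sum_i ev (- cc i) y *: r i.
  move=> yL; rewrite {1}(LQ y yL) mulmx_sum_row; apply: eq_bigr => i _.
  by rewrite ME evNl.
exists (fun i => - cc i), r; split => //.
- by move=> x i Px; rewrite evNl oppr_ge0 ccP.
- by move=> x Px; apply: LE; apply: P_span.
move=> i.
have [||l [l0 rlE]] := key (r i); first by rewrite /r rowE.
  by move=> j; rewrite -oppr_ge0 -evNl rE ler0n.
have a_pos j k : 0 <= ev (- cc k) (a j).
  by rewrite evNl oppr_ge0; apply: ccP; apply: mem_polytope.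
(* For [k] other than [i], the coordinate [k] of [r i] is 0 and a sum of nonnegative terms. So a
   generator used with nonzero weight in [r i] is a multiple of [r i]. *)
have la k j : k != i -> l j * ev (- cc k) (a j) = 0.
  move=> ki; have : \sum_j l j * ev (- cc k) (a j) == 0.
    by under eq_bigr do rewrite -evZ; rewrite -ev_sum -rlE rE (negbTE ki).
  rewrite psumr_eq0 => [/allP/(_ j (mem_index_enum _))/eqP//|k' _].
  by rewrite mulr_ge0.
have [j lj] : exists j, l j * ev (- cc i) (a j) != 0.
  apply: contrapT => /forallNP H.
  have : ev (- cc i) (r i) = 0.
    rewrite rlE ev_sum big1 // => j _; rewrite evZ.
    by apply/eqP/negPn/negP/H.
  by rewrite rE eqxx => /eqP; rewrite oner_eq0.
have [lj0 aj0] : l j != 0 /\ ev (- cc i) (a j) != 0.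
  by apply/andP; rewrite -negb_or -mulf_eq0.
exists s`_j, (ev (- cc i) (a j)); split.
- by rewrite lt_neqAle eq_sym aj0 a_pos.
- exact: mem_polytope.
rewrite -/(a j) {1}(LE (a j)) // (bigD1 i) //= big1 ?addr0 // => k ki.
by have /eqP := la k j ki; rewrite mulf_eq0 (negbTE lj0) => /eqP ->; rewrite scale0r.
Qed.
End TangentCone.

(** * Edges and faces at a vertex of a simple polytope *)

Section VertexStar.
Local Open Scope ring_scope.
Local Open Scope classical_set_scope.
Variables (R : realType) (n : nat).
Implicit Types (P F : set 'rV[R]_n) (v w x : 'rV[R]_n).

Lemma conv_hull2 v w x : conv_hull [set v; w] x <->
  exists2 t : R, 0 <= t <= 1 & x = v + t *: (w - v).
Proof.
split.
  move=> [m [p [a [pA a0 a1 ->]]]]; exists (\sum_(i | p i == w) a i).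
    rewrite sumr_ge0 //= -a1 [leRHS](bigID (fun i => p i == w)) /= lerDl.
    exact: sumr_ge0.
  apply/eqP; rewrite addrC -subr_eq -{1}[v]scale1r -a1 !scaler_suml -sumrB; apply/eqP.
  rewrite (bigID (fun i => p i == w)) /= [X in _ + X]big1 => [|i].
    by rewrite addr0; apply: eq_bigr => i /eqP ->; rewrite scalerBr.
  by case: (pA i) => -> /eqP // _; rewrite subrr.
move=> [t /andP[t0 t1] ->].
exists 2%N, (fun i => if i == ord0 then v else w), (fun i => if i == ord0 then 1 - t else t).
split => [i|i||].
- by case: (i == ord0); [left|right].
- by case: (i == ord0); rewrite ?subr_ge0.
- by rewrite !big_ord_recl big_ord0 /= addr0 subrK.
rewrite !big_ord_recl big_ord0 /= addr0 scalerBl scale1r scalerBr.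
by rewrite addrAC addrA.
Qed.

(* u lists the neighbors of v, and the faces at v are spanned by sets of them *)
Definition star P v d (u : 'I_d -> 'rV[R]_n) : Prop :=
  [/\ injective u,
      forall w, edge P v w <-> exists i, w = u i,
      forall F, face P F -> F v -> forall x, F x -> exists l : 'I_d -> R,
        [/\ forall i, 0 <= l i, forall i, l i != 0 -> F (u i) &
            x - v = \sum_i l i *: (u i - v)],
      forall I : {set 'I_d}, exists F,
        [/\ face P F, F v & forall i, F (u i) <-> i \in I] &
      forall F k, face P F -> F v ->
        (has_dim F k <-> #|[set i | `[<F (u i)>] ]%SET| = k)].

(** The neighbor [u i] is the last point of [P] on the ray [r i], and faces with prescribed
    neighbors arise by setting the orthant coordinates outside [I] to 0. *)
Lemma star_exists P d v : polytope P -> simple P d -> vertices P v ->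
  exists u : 'I_d -> 'rV[R]_n, star P v u.
Proof.
move=> [s PE]; rewrite {P}PE; set P := conv_hull _ => simpleP vertexv.
have [c [r [c0 cE cr ray]]] := tangent_cone_orthant simpleP vertexv.
have Pv : P v by apply: (face_sub vertexv).
pose G (I : {set 'I_d}) : set 'rV[R]_n :=
  [set x | P x /\ forall i, i \notin I -> ev (c i) (x - v) = 0].
have Gv I : G I v by split => // i _; rewrite subrr ev0.
have fG I : face P (G I).
  (* The coordinates are nonnegative on [P], so the negated sum of those outside [I] is maximal
     exactly where all of them vanish. *)
  pose e := - \sum_(i | i \notin I) c i.
  have eE x : ev e x = ev e v - \sum_(i | i \notin I) ev (c i) (x - v).
    by rewrite addrC -ev_suml -[- _]evNl evB subrK.
  apply/faceP; exists e, (ev e v); split => [x Px|].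
    by rewrite eE gerBl sumr_ge0 // => i _; apply: c0.
  apply/seteqP; split => x /= [Px].
    by move=> H; split => //; rewrite eE big1 // subr0.
  move=> /eqP; rewrite eE -subr_eq0 addrAC subrr add0r oppr_eq0.
  rewrite psumr_eq0 => [/allP H|i _]; last exact: c0.
  by split => // i iI; apply/eqP; have := H i (mem_index_enum _); rewrite iI.
have G1E i x : G [set i]%SET x -> x - v = ev (c i) (x - v) *: r i.
  move=> [Px H]; rewrite {1}(cE x Px) (bigD1 i) //= big1 ?addr0 // => j ji.
  by rewrite H ?scale0r // inE.
have farthest i : exists uk : 'rV[R]_n * R, [/\ 0 < uk.2, uk.1 - v = uk.2 *: r i,
    vertices P uk.1 & forall x, G [set i]%SET x -> ev (c i) (x - v) <= uk.2].
  have [|b [x0 [Gx0 cx0 cmax fx0]]] := face_max (c i) (fG [set i]%SET); first by exists v.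
  exists (x0, ev (c i) (x0 - v)); split => //=.
  - have [u' [k [k0 Pu' u'E]]] := ray i.
    have Gu' : G [set i]%SET u'.
      split => // j; rewrite inE => /negbTE ji.
      by rewrite u'E evZ cr ji mulr0.
    apply: (lt_le_trans k0); have := cmax u' Gu'.
    have : k = ev (c i) (u' - v) by rewrite u'E evZ cr eqxx mulr1.
    by rewrite !evB cx0 => ->; rewrite lerD2r.
  - exact: G1E.
  - rewrite /vertices /=; congr (face _ _): fx0; apply/seteqP; split => x /=.
      move=> [Gx cx]; apply: (addIr (- v)); rewrite (G1E _ _ Gx) (G1E _ _ Gx0).
      by rewrite !evB cx cx0.
    by move=> ->.
  - by move=> x Gx; rewrite !evB lerD2r cx0 cmax.
have [uk ukP] := choice farthest; pose u i := (uk i).1; pose k i := (uk i).2.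
have k0 i : 0 < k i by case: (ukP i).
have uE i : u i - v = k i *: r i by case: (ukP i).
have vu i : vertices P (u i) by case: (ukP i).
have Gmax i x : G [set i]%SET x -> ev (c i) (x - v) <= k i by case: (ukP i) => _ _ _; apply.
have cu i j : ev (c i) (u j - v) = k j *+ (i == j).
  by rewrite uE evZ cr mulr_natr.
have GuI I i : G I (u i) <-> i \in I.
  split => [[_ H]|iI].
    apply: contraT => /(H i)/eqP.
    by rewrite cu eqxx mulr1n gt_eqF.
  split; first exact: (face_sub (vu i)).
  by move=> j jI; rewrite cu; case: eqP jI iI => [->/negbTE->|_ _ _]; rewrite ?mulr0n.
have u_inj : injective u.
  move=> i j uij; apply/eqP; have := cu i j; rewrite -uij cu eqxx mulr1n.
  by case: eqP => // _ /eqP; rewrite mulr0n gt_eqF.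
(* A functional exposing [F] does not increase along any ray. At a point of [F], each ray with
   nonzero coordinate must therefore keep it constant, which puts [u i] into [F]. *)
have cone F : face P F -> F v -> forall x, F x -> exists l : 'I_d -> R,
    [/\ forall i, 0 <= l i, forall i, l i != 0 -> F (u i) &
        x - v = \sum_i l i *: (u i - v)].
  move=> /faceP[e [b [Pb FE]]] Fv x Fx.
  have Px : P x by move: Fx; rewrite FE => -[].
  have ev_v : ev e v = b by move: Fv; rewrite FE => -[].
  have er i : ev e (r i) <= 0.
    have [u' [k' [k'0 Pu' u'E]]] := ray i.
    by rewrite -(pmulr_rle0 _ k'0) -evZ -u'E evB ev_v subr_le0 Pb.
  exists (fun i => ev (c i) (x - v) / k i); split.
  - by move=> i; apply: divr_ge0; [exact: c0|exact: ltW].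
  - move=> i; rewrite mulf_eq0 negb_or => /andP[cx _].
    have : ev e (x - v) = 0.
      by move: Fx; rewrite FE => -[_ ex]; rewrite evB ex ev_v subrr.
    rewrite (cE x Px) ev_sum => /eqP; rewrite -oppr_eq0 -sumrN psumr_eq0; last first.
      by move=> j _; rewrite evZ -mulrN mulr_ge0 ?c0 // oppr_ge0.
    move=> /allP/(_ i (mem_index_enum _)).
    rewrite oppr_eq0 evZ mulf_eq0 (negbTE cx) /= => /eqP ri.
    rewrite FE; split; first exact: (face_sub (vu i)).
    by rewrite -[u i](subrK v) evD uE evZ ri mulr0 add0r.
  rewrite {1}(cE x Px); apply: eq_bigr => i _.
  by rewrite uE scalerA divfK // gt_eqF.
exists u; split => //.
- move=> w; split.
    move=> [_ vw neq fF]; set F := conv_hull _ in fF.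
    have Fv : F v by apply: sub_conv_hull; left.
    have Fw : F w by apply: sub_conv_hull; right.
    have [l [_ lF wE]] := cone F fF Fv w Fw.
    have [i li] : exists i, l i != 0.
      apply: contrapT => /forallNP H; apply: neq; apply/esym/eqP.
      rewrite -subr_eq0 wE big1 // => i _.
      by have /negP/negPn/eqP -> := H i; rewrite scale0r.
    (* [u i] lies on the segment from [v] to [w]. A functional exposing the vertex [u i] is smaller
       at [v], so it must reach its maximum at [w], whence [w = u i]. *)
    exists i; have /conv_hull2[t /andP[t0 t1] uiE] := lF i li.
    have /faceP[e [b [Pb viE]]] := vu i.
    have uniq_max x : P x -> ev e x = b -> x = u i.
      by move=> Px ex; have : [set x | P x /\ ev e x = b] x by []; rewrite -viE.
    have eui : ev e (u i) = b.
      have : [set u i] (u i) by []; by rewrite viE => -[].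
    have v_ui : v <> u i.
      move=> E; have := k0 i; have := cu i i.
      by rewrite -E subrr ev0 eqxx mulr1n => <-; rewrite ltxx.
    have ev_lt : ev e v < b.
      by rewrite lt_neqAle Pb // andbT; apply/eqP => /(uniq_max v Pv).
    have Pw : P w := face_sub vw erefl.
    apply: uniq_max => //; apply/eqP; rewrite eq_le Pb //=.
    move: eui; rewrite uiE evD evZ evB => eui.
    have tWA : t * (ev e w - ev e v) = b - ev e v by rewrite -eui addrAC subrr add0r.
    have t_gt0 : 0 < t.
      rewrite lt_neqAle t0 andbT; apply/eqP => tE; move: tWA ev_lt.
      by rewrite -tE mul0r => /esym/eqP; rewrite subr_eq0 => /eqP ->; rewrite ltxx.
    have WA : 0 < ev e w - ev e v by rewrite -(pmulr_rgt0 _ t_gt0) tWA subr_gt0.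
    by rewrite -(lerD2r (- ev e v)) -tWA ger_pMl.
  move=> [i ->]; split => //.
    move=> E; have := k0 i; have := cu i i.
    by rewrite -E subrr ev0 eqxx mulr1n => <-; rewrite ltxx.
  rewrite (_ : conv_hull _ = G [set i]%SET); first exact: fG.
  apply/seteqP; split => x.
    rewrite (face_conv_hull (fG [set i]%SET)); apply: conv_hull_mono => y [->|->].
      by split; [exact: vertex_mem|].
    by split; [exact: vertex_mem|apply/GuI; rewrite inE].
  move=> Gx; apply/conv_hull2; exists (ev (c i) (x - v) / k i).
    apply/andP; split.
      by apply: divr_ge0; [apply: c0; case: Gx|exact: ltW].
    by rewrite ler_pdivrMr // mul1r Gmax.
  by rewrite uE scalerA divfK ?gt_eqF // -G1E // addrC subrK.
- by move=> I; exists (G I).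
move=> F m fF Fv.
pose I := [set i | `[<F (u i)>] ]%SET.
(* The edge vectors are independent: the coordinate [c j] is nonzero at [u j - v] and vanishes at
   the others. *)
have fr (J : seq 'I_d) : uniq J -> free [seq u i - v | i <- J].
  elim: J => [|j J IH] /=; first by rewrite nil_free.
  move=> /andP[jJ uJ]; rewrite free_cons IH // andbT; apply/negP => H.
  have := cu j j; rewrite eqxx mulr1n.
  rewrite (coord_span (X := in_tuple _) H) ev_sum big1 => [kj|i _].
    by have := k0 j; rewrite -kj ltxx.
  rewrite evZ; have : (in_tuple [seq u i - v | i <- J])`_i \in [seq u i - v | i <- J].
    exact: mem_nth.
  case/mapP => j' j'J ->; rewrite cu; case: eqP => [jj'|]; last by rewrite mulr0n mulr0.
  by rewrite jj' j'J in jJ.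
have Fdim : has_dim F #|I|.
  have := fr (enum I) (enum_uniq _); rewrite /free size_map -cardE => /eqP <-.
  apply: (@has_dim_span _ _ _ v) => //.
    move=> y /mapP[i]; rewrite mem_enum inE => /asboolP Fi ->.
    by rewrite addrC subrK.
  move=> x Fx; have [l [_ lF ->]] := cone F fF Fv x Fx.
  apply: memv_suml => i _; have [->|/lF Fi] := eqVneq (l i) 0.
    by rewrite scale0r mem0v.
  apply/memvZ/memv_span/map_f; rewrite mem_enum inE; exact/asboolP.
split => [Fm|<- //]; apply: has_dim_unique Fdim Fm; by exists v.
Qed.
End VertexStar.

(** * Two-faces and sinks *)

(** The relation acts as an injection without a chosen map: a partner of the head is removed from
    [B], and injectivity shows that the tail does not use it. *)
Lemma leq_size_rel (T U : eqType) (A : seq T) (B : seq U) (r : T -> U -> Prop) :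
    uniq A -> (forall a, a \in A -> exists2 b, b \in B & r a b) ->
    (forall a a' b, a \in A -> a' \in A -> b \in B -> r a b -> r a' b -> a = a') ->
  (size A <= size B)%N.
Proof.
elim: A B => // a A IH B /= /andP[aA uA] tot inj.
have [b bB rab] := tot a (mem_head _ _).
rewrite (perm_size (perm_to_rem bB)) /= ltnS; apply: IH => //.
  move=> a' a'A; have [|b' b'B ra'b'] := tot a'; first by rewrite inE a'A orbT.
  exists b' => //; move: b'B; rewrite (perm_mem (perm_to_rem bB)) inE.
  case/orP => // /eqP b'b; rewrite b'b in ra'b'; move: aA.
  by rewrite (inj a a' b) ?a'A // inE ?eqxx ?a'A ?orbT.
move=> a1 a2 b' a1A a2A b'B; apply: inj; rewrite ?inE ?a1A ?a2A ?orbT //.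
exact: mem_rem b'B.
Qed.

Section SimplePolytope.
Local Open Scope ring_scope.
Local Open Scope classical_set_scope.
Variables (R : realType) (n d : nat) (P : set 'rV[R]_n).
Hypotheses (polytopeP : polytope P) (simpleP : simple P d).
Implicit Types (F G : set 'rV[R]_n) (u v w a b x : 'rV[R]_n) (O : rel 'rV[R]_n).
Implicit Types (h : 'cV[R]_n).

Lemma edge_sym u v : edge P u v -> edge P v u.
Proof. by move=> [Pu Pv uv fuv]; split => //; [exact: nesym|rewrite setUC]. Qed.

Lemma two_face_exists v a b : edge P v a -> edge P v b -> a <> b ->
  exists F, [/\ kface P 2 F, F v, F a & F b].
Proof.
move=> va vb ab; have [Pv _ _ _] := va.
have [u [uinj uedge _ uface udim]] := star_exists polytopeP simpleP Pv.
have [i ai] := (uedge a).1 va; have [j bj] := (uedge b).1 vb.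
have [F [fF Fv FI]] := uface [set i; j]%SET.
have Fa : F a by rewrite ai; apply/FI; rewrite !inE eqxx.
have Fb : F b by rewrite bj; apply/FI; rewrite !inE eqxx orbT.
exists F; split => //; split => //; apply/udim => //.
rewrite (_ : finset _ = [set i; j]%SET); last first.
  by apply/setP => k; rewrite inE; apply/asboolP/idP => /FI.
by rewrite cards2; case: eqP => // ij; case: ab; rewrite ai bj ij.
Qed.

Lemma two_face_neighbors F v : kface P 2 F -> vertices P v -> F v ->
  exists a b, [/\ a <> b, edge P v a /\ F a, edge P v b /\ F b &
    forall w, edge P v w -> F w -> w = a \/ w = b].
Proof.
move=> [fF dF] Pv Fv.
have [u [uinj uedge _ _ udim]] := star_exists polytopeP simpleP Pv.
have /eqP/cards2P[i [j [ij FE]]] := (udim F 2 fF Fv).1 dF.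
have FiE k : F (u k) <-> k = i \/ k = j.
  have : k \in [set i | `[<F (u i)>] ]%SET = (k \in [set i; j]%SET) by rewrite FE.
  rewrite !inE => E; split.
    by move=> /asboolT; rewrite E => /orP[/eqP|/eqP]; [left|right].
  by move=> H; apply/asboolP; rewrite E; case: H => ->; rewrite eqxx ?orbT.
exists (u i), (u j); split.
- by move=> /uinj E; rewrite E eqxx in ij.
- by split; [apply/uedge; exists i|apply/FiE; left].
- by split; [apply/uedge; exists j|apply/FiE; right].
by move=> w /uedge[k ->] /FiE[] ->; [left|right].
Qed.

(** Points of [F] are reached from [v] by nonnegative combinations of edges of [F] at [v], and the
    functional exposing [G] is constant along these edges. *)
Lemma face_sub_neighbors F G v : face P F -> face P G -> vertices P v ->
  F v -> G v -> (forall w, edge P v w -> F w -> G w) -> F `<=` G.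
Proof.
move=> fF fG Pv Fv Gv FG x Fx.
have [u [_ uedge ucone _ _]] := star_exists polytopeP simpleP Pv.
have [l [_ lF xE]] := ucone F fF Fv x Fx.
have [c [b [Pb GE]]] := fG; have cv : ev c v = b by move: Gv; rewrite GE => -[].
have Px : P x by case: fF Fx => ? [? [_ ->]] [].
rewrite GE; split => //; rewrite -[LHS]/(ev c x) -(subrK v x) evD cv xE ev_sum.
rewrite big1 ?add0r // => i _; have [->|/lF Fi] := eqVneq (l i) 0.
  by rewrite scale0r ev0.
have : G (u i) by apply: FG => //; apply/uedge; exists i.
by rewrite GE => -[_ ci]; rewrite evZ evB cv /ev ci subrr mulr0.
Qed.

Lemma two_face_sub F G v a b : kface P 2 F -> face P G ->
  edge P v a -> edge P v b -> a <> b -> F v -> F a -> F b -> G v -> G a -> G b ->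
  F `<=` G.
Proof.
move=> kF fG va vb ab Fv Fa Fb Gv Ga Gb; have [Pv _ _ _] := va.
apply: (face_sub_neighbors kF.1 fG Pv) => // w vw Fw.
have [a' [b' [_ _ _ H]]] := two_face_neighbors kF Pv Fv.
have := H w vw Fw; have := H a va Fa; have := H b vb Fb.
by move=> [E1|E1] [E2|E2] [E3|E3]; subst.
Qed.

Lemma two_face_unique F G v a b : kface P 2 F -> kface P 2 G ->
  edge P v a -> edge P v b -> a <> b -> F v -> F a -> F b -> G v -> G a -> G b ->
  F = G.
Proof.
move=> kF kG va vb ab Fv Fa Fb Gv Ga Gb; apply/seteqP; split.
  by apply: (two_face_sub kF kG.1 va vb).
by apply: (two_face_sub kG kF.1 va vb).
Qed.

Lemma face_local_min h G v : face P G -> vertices P v -> G v ->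
  (forall w, edge P v w -> G w -> ev h v <= ev h w) ->
  forall x, G x -> ev h v <= ev h x.
Proof.
move=> fG Pv Gv vmin x Gx.
have [u [_ uedge ucone _ _]] := star_exists polytopeP simpleP Pv.
have [l [l0 lG xE]] := ucone G fG Gv x Gx.
rewrite -subr_ge0 -evB xE ev_sum sumr_ge0 // => i _.
have [->|/lG Gi] := eqVneq (l i) 0; first by rewrite scale0r ev0.
by rewrite evZ mulr_ge0 // evB subr_ge0 vmin //; apply/uedge; exists i.
Qed.

Lemma vertices_enum : exists2 vs, uniq vs & forall v, vertices P v <-> v \in vs.
Proof.
have [s PE] := polytopeP; apply: finite_enum.
apply: (@sub_finite_set _ _ [set` s]); last exact: finite_seq.
by rewrite PE => v; apply: vertex_mem.
Qed.

Lemma two_faces_enum : exists2 fs, uniq fs & forall F, kface P 2 F <-> F \in fs.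
Proof.
have [s PE] := polytopeP; apply: finite_enum.
by apply: (sub_finite_set _ (finite_faces s)); rewrite -PE => F [].
Qed.

Lemma face_has_vertex F : face P F -> F !=set0 -> exists2 v, vertices P v & F v.
Proof. by have [s ->] := polytopeP; apply: face_vertex. Qed.

Definition separates h := forall u v, vertices P u -> vertices P v -> u <> v ->
  ev h u <> ev h v.

(** The functional exposing [F] is larger on [F] than elsewhere, and making it generic preserves its
    strict inequalities between generators. *)
Lemma top_functional F : face P F -> exists2 h, separates h &
  forall u v, vertices P u -> vertices P v -> F u -> ~ F v -> ev h v < ev h u.
Proof.
have [s PE] := polytopeP.
have vs u : vertices P u -> u \in s by rewrite PE; apply: vertex_mem.
move=> [c [b [Pb FE]]]; have [h [hinj hc]] := generic_on_seq s c.
exists h => [u v /vs us /vs vs'|u v Pu Pv]; first exact: hinj.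
have inP z : vertices P z -> P z.
  by move=> /vs; rewrite PE; apply: mem_polytope.
rewrite FE => -[_ cu] Fv; apply: hc; [exact: vs|exact: vs|].
rewrite lt_neqAle [X in _ && X](_ : _ = true); last first.
  by rewrite -[ev c u]/((u *m c) 0 0) cu; apply/Pb/inP.
rewrite andbT; apply/eqP => E; apply: Fv; split; first exact: inP.
by rewrite -cu.
Qed.

Lemma separating_functional : exists h, separates h.
Proof.
(* The empty face makes the second property vacuous; it is exposed by the zero functional with bound
   1. *)
have [|h hsep _] := @top_functional set0; last by exists h.
exists 0, 1; split => [x _|].
  by rewrite mulmx0 mxE ler01.
apply/seteqP; split => // x [_ /eqP].
by rewrite mulmx0 mxE eq_sym oner_eq0.
Qed.

Lemma exists_min (f : 'rV[R]_n -> R) (Q : 'rV[R]_n -> Prop) v0 :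
  vertices P v0 -> Q v0 ->
  exists v, [/\ vertices P v, Q v & forall w, vertices P w -> Q w -> f v <= f w].
Proof.
have [vs _ vsE] := vertices_enum => Pv0 Qv0.
have [|v] := seq_argmax (fun x => - f x) (x0 := v0) (s := [seq v <- vs | `[<Q v>]]).
  by rewrite mem_filter; apply/andP; split; [exact/asboolP|exact/vsE].
rewrite mem_filter => /andP[/asboolP Qv /vsE Pv] vmin.
exists v; split => // w /vsE Pw Qw; rewrite -lerN2.
by apply: vmin; rewrite mem_filter Pw andbT; apply/asboolP.
Qed.

(* A vertex set closed under the edges of G and its complement in G would both
   contain the minimum over G of a generic linear functional. *)
Lemma face_connected G (Q : 'rV[R]_n -> Prop) v0 : face P G ->
  vertices P v0 -> G v0 -> Q v0 ->
  (forall u w, edge P u w -> G u -> G w -> Q u -> Q w) ->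
  forall w, vertices P w -> G w -> Q w.
Proof.
move=> fG Pv0 Gv0 Qv0 Qcl w Pw Gw; apply: contrapT => NQw.
have [h hsep] := separating_functional.
have [m [Pm [Gm Qm] mmin]] :=
  exists_min (ev h) (Q := fun v => G v /\ Q v) Pv0 (conj Gv0 Qv0).
have [m' [Pm' [Gm' Qm'] m'min]] :=
  exists_min (ev h) (Q := fun v => G v /\ ~ Q v) Pw (conj Gw NQw).
have mG := @face_local_min h G m fG Pm Gm.
have m'G := @face_local_min h G m' fG Pm' Gm'.
apply: (hsep m m') => //; first by move=> E; rewrite -E in Qm'.
apply/eqP; rewrite eq_le mG ?m'G // => u eu Gu; have [_ Pu _ _] := eu.
  apply: m'min => //; split => // Qu; apply: Qm'.
  by apply: Qcl Qu => //; apply: edge_sym.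
by apply: mmin => //; split => //; apply: Qcl Qm.
Qed.

Definition sink O F v := vertices P v /\ is_sink O F v.

Lemma sink_exists O (f : 'rV[R]_n -> R) F : orientation P O ->
  (forall u v, O u v -> f v < f u) -> face P F -> F !=set0 ->
  exists v, sink O F v.
Proof.
move=> oO Of fF F0; have [v0 Pv0 Fv0] := face_has_vertex fF F0.
have [v [Pv Fv vmin]] := exists_min f Pv0 Fv0.
exists v; do 2!split => //; move=> u Fu; apply/negP => vu.
have [_ Pu _ _] := oO.1 _ _ vu.
by have := Of _ _ vu; rewrite ltNge vmin.
Qed.

Definition linear_orientation h : rel 'rV[R]_n :=
  fun u v => `[<edge P u v>] && (ev h v < ev h u).

Lemma linear_orientationP h : separates h ->
  orientation P (linear_orientation h).
Proof.
move=> hsep; split => u v; first by move=> /andP[/asboolP].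
move=> uv; have vu := edge_sym uv; have [Pu Pv neq _] := uv.
rewrite /linear_orientation (asboolT uv) (asboolT vu) /=.
by have [] := ltgtP (ev h u) (ev h v) => //; move/(hsep u v Pu Pv neq).
Qed.

Lemma linear_sink_unique h G u v : separates h -> face P G ->
  sink (linear_orientation h) G u -> sink (linear_orientation h) G v -> u = v.
Proof.
move=> hsep fG; have min w : sink (linear_orientation h) G w ->
    forall x, G x -> ev h w <= ev h x.
  move=> [Pw [Gw wsink]]; apply: face_local_min => // y wy Gy.
  by have := wsink y Gy; rewrite /linear_orientation (asboolT wy) /= -leNgt.
move=> su sv; have := min _ su v sv.2.1; have := min _ sv u su.2.1.
move=> vu uv; apply: contrapT => neq; apply: (hsep u v su.1 sv.1 neq).
by apply/eqP; rewrite eq_le uv vu.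
Qed.

(** [v] is a sink of [F] exactly if both edges of [F] at [v] enter [v]. As 2-faces at [v] correspond
    to pairs of edges, those with sink [v] correspond to pairs of in-neighbors. *)
Lemma sinks_in_two_faces O v fs : orientation P O -> vertices P v ->
    uniq fs -> (forall F, kface P 2 F <-> F \in fs) ->
  (indegree O v <= d)%N /\
  count (fun F => `[<sink O F v>]) fs = 'C(indegree O v, 2).
Proof.
move=> oO Pv ufs fsE.
have [u [uinj uedge _ uface udim]] := star_exists polytopeP simpleP Pv.
pose I := [set i | O (u i) v]%SET.
have Ov w : O w v -> exists i, w = u i.
  by move=> wv; apply/uedge/edge_sym; apply: oO.1 wv.
have -> : indegree O v = #|I|.
  rewrite cardE -(size_map u); apply: ncardE.
    by rewrite map_inj_uniq // enum_uniq.
  move=> w; split => /=.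
    by move=> wv; have [i E] := Ov w wv; rewrite E map_f // mem_enum inE -E.
  by case/mapP => i; rewrite mem_enum inE => iv ->.
split; first by rewrite -[d in leqRHS]card_ord max_card.
pose r F (J : {set 'I_d}) := forall i, F (u i) <-> i \in J.
have sinkE F : F v -> sink O F v <-> forall i, F (u i) -> O (u i) v.
  move=> Fv; split.
    move=> [_ [_ Fsink]] i Fi; have := Fsink _ Fi; apply: contraNT.
    have /oO.2 : edge P v (u i) by apply/uedge; exists i.
    by case: (O v _) => //= ->.
  move=> H; do 2!split => //; move=> w Fw; apply/negP => vw.
  have /oO.2 := oO.1 _ _ vw; rewrite vw /=.
  have [i E] := (uedge w).1 (oO.1 _ _ vw).
  by rewrite E H // -E.
rewrite -size_filter -cards_draws cardE; apply/eqP; rewrite eqn_leq.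
apply/andP; split.
  apply: (@leq_size_rel _ _ _ _ r); first exact: filter_uniq.
    move=> F; rewrite mem_filter => /andP[/asboolP sF /fsE kF].
    exists [set i | `[<F (u i)>] ]%SET; last first.
      by move=> i; rewrite inE; split => [|/asboolP//]; apply: asboolT.
    rewrite mem_enum inE; apply/andP; split.
      apply/fintype.subsetP => i; rewrite !inE => Fi.
      exact: ((sinkE F sF.2.1).1 sF i Fi).
    by apply/eqP/udim; [exact: kF.1|exact: sF.2.1|exact: kF.2].
  move=> F G J; rewrite !mem_filter => /andP[/asboolP sF /fsE kF].
  move=> /andP[/asboolP sG /fsE kG] _ FJ GJ.
  have [Fv Gv] := (sF.2.1, sG.2.1).
  have H w : edge P v w -> F w <-> G w.
    by move=> /uedge[i ->]; rewrite FJ GJ.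
  by apply/seteqP; split; apply: (face_sub_neighbors (v := v)) => //;
    [exact: kF.1|exact: kG.1|move=> w /H[]|exact: kG.1|exact: kF.1|move=> w /H[]].
apply: (@leq_size_rel _ _ _ _ (fun J F => r F J)); first exact: enum_uniq.
  move=> J; rewrite mem_enum inE => /andP[/fintype.subsetP JI /eqP J2].
  have [F [fF Fv FJ]] := uface J; exists F => //.
  rewrite mem_filter; apply/andP; split.
    by apply/asboolP/sinkE => // i /FJ/JI; rewrite inE.
  apply/fsE; split => //; apply/udim => //; rewrite -J2; congr #|pred_of_set _|.
  by apply/setP => i; rewrite inE; apply/asboolP/idP => /FJ.
move=> J J' F _ _ _ FJ FJ'; apply/setP => i.
by apply/idP/idP => [/FJ/FJ'|/FJ'/FJ].
Qed.

Lemma H2_sinks O vs fs : orientation P O ->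
    uniq vs -> (forall v, vertices P v <-> v \in vs) ->
    uniq fs -> (forall F, kface P 2 F <-> F \in fs) ->
  H2 P d O = (\sum_(F <- fs) count (fun v => `[<sink O F v>]) vs)%N.
Proof.
move=> oO uvs vsE ufs fsE.
have hE k : h_ k P O = count (fun v => indegree O v == k) vs.
  rewrite -size_filter; apply: ncardE; first exact: filter_uniq.
  move=> v; rewrite mem_filter /=; split.
    by move=> [/vsE -> ->]; rewrite eqxx.
  by move=> /andP[/eqP <- /vsE].
transitivity (\sum_(v <- vs) 'C(indegree O v, 2))%N.
  transitivity (\sum_(k < d.+1) \sum_(v <- vs | indegree O v == k) 'C(k, 2))%N.
    apply: eq_bigr => k _; rewrite hE -sum1_count big_distrl /=.
    by apply: eq_bigr => v _; rewrite mul1n.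
  rewrite (exchange_big_dep xpredT) //= big_seq [RHS]big_seq.
  apply: eq_bigr => v /vsE Pv.
  (* In-degrees are at most [d], so each vertex is counted under exactly one index of the sum. *)
  have [vd _] := sinks_in_two_faces oO Pv ufs fsE.
  have vd' : (indegree O v < d.+1)%N by rewrite ltnS.
  by rewrite (big_pred1 (Ordinal vd')) ?mul1n // => i; rewrite eq_sym.
transitivity (\sum_(v <- vs) count (fun F => `[<sink O F v>]) fs)%N.
  rewrite big_seq [RHS]big_seq; apply: eq_bigr => v /vsE Pv.
  by have [_ ->] := sinks_in_two_faces oO Pv ufs fsE.
under eq_bigr do rewrite -sum1_count big_mkcond /=.
under [RHS]eq_bigr do rewrite -sum1_count big_mkcond /=.
exact: exchange_big.
Qed.

End SimplePolytope.

Lemma leq_size_sum (T : eqType) (s : seq T) (g : T -> nat) :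
  (forall x, x \in s -> 0 < g x)%N ->
  (size s <= \sum_(x <- s) g x)%N /\
  (size s = (\sum_(x <- s) g x)%N <-> forall x, x \in s -> g x = 1%N).
Proof.
elim: s => [|a s IH] g0; first by rewrite big_nil.
have [|le_s eq_s] := IH; first by move=> x xs; apply: g0; rewrite inE xs orbT.
have ga := g0 a (mem_head _ _).
rewrite big_cons /=; split; first by lia.
split => [E x|H].
  have [Es Ea] : size s = (\sum_(x <- s) g x)%N /\ g a = 1%N by lia.
  by rewrite inE => /orP[/eqP -> //|]; apply: (eq_s.1 Es).
rewrite (H a (mem_head _ _)) add1n; congr _.+1; apply/eq_s => x xs.
by apply: H; rewrite inE xs orbT.
Qed.

Lemma count_eq1 (T : eqType) (s : seq T) (p : pred T) : uniq s ->
  count p s = 1%N <-> exists2 x, x \in s & p x /\ forall y, y \in s -> p y -> y = x.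
Proof.
move=> us; rewrite -size_filter; split.
  case E: (filter p s) => [|x [|]] // _; have : x \in filter p s by rewrite E mem_head.
  rewrite mem_filter => /andP[px xs]; exists x => //; split => // y ys py.
  have : y \in filter p s by rewrite mem_filter py.
  by rewrite E inE => /eqP.
move=> [x xs [px H]]; apply: (@perm_size _ _ [:: x]); apply: uniq_perm => //.
  exact: filter_uniq.
move=> y; rewrite mem_filter inE; apply/andP/eqP => [[py ys]|->//]; exact: H.
Qed.

(** * Sinks of faces under an acyclic orientation *)

Section Orientations.
Local Open Scope ring_scope.
Local Open Scope classical_set_scope.
Variables (R : realType) (n d : nat) (P : set 'rV[R]_n).
Hypotheses (polytopeP : polytope P) (simpleP : simple P d).
Implicit Types (F G : set 'rV[R]_n) (u v w x : 'rV[R]_n).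
Variable O : rel 'rV[R]_n.
Hypothesis orientationO : orientation P O.

(** The number of vertices reachable from a vertex drops along every directed edge, so sorting by it
    gives a compatible numbering. *)
Lemma acyclic_numbering : acyclic O -> exists2 phi, numbering P phi &
  forall u v, O u v = induced_orientation P phi u v.
Proof.
move=> acyclicO; have [vs uvs vsE] := vertices_enum polytopeP.
pose e := relpre (val : seq_sub vs -> 'rV[R]_n) O.
pose rho v := oapp (fun x : seq_sub vs => #|connect e x|) 0%N (insub v).
have rho_lt u v : O u v -> (rho v < rho u)%N.
  move=> uv; have [/vsE us /vsE ws _ _] := orientationO.1 _ _ uv.
  rewrite /rho !insubT /=; set x : seq_sub vs := Sub u _; set y : seq_sub vs := Sub v _.
  have exy : e x y by [].
  apply: proper_card; apply/fintype.properP; split.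
    by apply/fintype.subsetP => z; apply: connect_trans; apply: connect1.
  (* [x] itself is lost: a path from [y] back to [x] would close up with the edge from [x] to
     [y]. *)
  exists x; first exact: connect0.
  apply/negP => /connectP[p yp xE].
  have /negP := @acyclicO (map val (y :: p)) isT; apply.
  have : path O (val y) (map val (rcons p y)) by rewrite path_map rcons_path yp -xE.
  by rewrite map_rcons.
pose vs' := sort (relpre rho leq) vs.
have vs'E v : vertices P v <-> v \in vs' by rewrite mem_sort.
have uvs' : uniq vs' by rewrite sort_uniq.
(* The successor is taken because numberings start at 1. *)
pose phi v := (index v vs').+1.
have phi_lt u v : O u v -> (phi v < phi u)%N.
  move=> uv; have [/vs'E us /vs'E ws _ _] := orientationO.1 _ _ uv.
  rewrite /phi ltnS ltnNge; apply/negP; rewrite leq_eqVlt => /orP[/eqP E|].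
    have := rho_lt _ _ uv; rewrite -(nth_index 0 us) E nth_index // ltnn //.
  have rt : transitive (relpre rho leq) by move=> ? ? ?; apply: leq_trans.
  have st : sorted (relpre rho leq) vs'.
    by apply: sort_sorted => ? ?; apply: leq_total.
  move=> /(sorted_ltn_index rt st _ _ us ws) /=.
  by rewrite leqNgt rho_lt.
exists phi; last first.
  move=> u v; apply/idP/andP => [uv|[/asboolP uv vu]].
    by split; [apply/asboolP/(orientationO.1 _ _ uv)|exact: phi_lt].
  have := orientationO.2 _ _ uv; case: (boolP (O v u)) => [/phi_lt|_].
    by rewrite ltnNge ltnW.
  by case: (O u v).
have sz : ncard (vertices P) = size vs' by apply: ncardE.
split.
- by move=> v /= /vs'E; rewrite sz /phi /= index_mem.
- move=> u v; rewrite !inE => /vs'E us /vs'E ws [] E.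
  by rewrite -(nth_index 0 us) E nth_index.
move=> k /=; rewrite sz => /andP[k0 kn].
have kn' : (k.-1 < size vs')%N by case: k k0 kn.
exists (nth 0 vs' k.-1); first exact/vs'E/mem_nth.
by rewrite /phi index_uniq // prednK.
Qed.

(** Directed paths that stay inside [G] and stop at a sink of [G]. *)
Inductive reach G : 'rV[R]_n -> 'rV[R]_n -> Prop :=
| reach_sink v : sink P O G v -> reach G v v
| reach_step v w s : G v -> O v w -> reach G w s -> reach G v s.

Lemma reach_in G v s : reach G v s -> G v.
Proof. by case=> // w [_ []]. Qed.

Lemma reach_end G v s : reach G v s -> sink P O G s.
Proof. by elim. Qed.

Lemma reach_trans F G v t s : F `<=` G -> reach F v t -> reach G t s -> reach G v s.
Proof.
move=> FG; elim => // {v}v w {}t Fv vw _ IH ts.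
by apply: reach_step vw (IH ts); apply: FG.
Qed.

Lemma reach_from_sink G v s : sink P O G v -> reach G v s -> s = v.
Proof.
move=> [_ [_ sv]] vs; case: vs sv => // {v}v w {}s Gv vw /reach_in Gw sv.
by have := sv w Gw; rewrite vw.
Qed.

Section UniqueSinks.
Variable phi : 'rV[R]_n -> nat.
Hypothesis phi_lt : forall u v, O u v -> (phi v < phi u)%N.

Lemma reach_exists G v : vertices P v -> G v -> exists s, reach G v s.
Proof.
have [k] := ubnP (phi v); elim: k v => // k IH v; rewrite ltnS => vk Pv Gv.
have [sv|nsv] := pselect (is_sink O G v).
  by exists v; apply: reach_sink.
have [w Gw vw] : exists2 w, G w & O v w.
  apply: contrapT => /forall2NP H; apply: nsv; split => // w Gw.
  by apply/negP => vw; case: (H w).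
have [_ Pw _ _] := orientationO.1 _ _ vw.
have [|//|//|s ws] := IH w; first exact: leq_trans (phi_lt vw) vk.
by exists s; apply: reach_step vw ws.
Qed.

Hypothesis two_face_sink : forall F u v, kface P 2 F ->
  sink P O F u -> sink P O F v -> u = v.

(* Two out-neighbors of v span with v a 2-face, whose unique sink is reachable
   from both of them. *)
Lemma reach_unique G v s s' : face P G -> reach G v s -> reach G v s' -> s = s'.
Proof.
move=> fG; have [k] := ubnP (phi v); elim: k v s s' => // k IH v s s'.
rewrite ltnS => vk vs; case: vs vk => {v s} [v sv|v w s Gv vw ws] vk.
  by move=> /(reach_from_sink sv) ->.
move=> vs'; case: vs' vk ws vw Gv => {v s'} [v sv|v w' s' _ vw' ws'] vk ws vw Gv.
  apply: (reach_from_sink sv); exact: reach_step vw ws.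
have lt_w x : O v x -> (phi x < k)%N.
  by move=> vx; apply: leq_trans (phi_lt vx) vk.
have [E|/eqP ww'] := eqVneq w w'.
  by subst w'; apply: IH ws ws'; apply: lt_w.
have [ew ew'] := (orientationO.1 _ _ vw, orientationO.1 _ _ vw').
have [F [kF Fv Fw Fw']] := two_face_exists polytopeP simpleP ew ew' ww'.
have FG : F `<=` G.
  apply: (two_face_sub polytopeP simpleP kF fG ew ew' ww') => //.
    exact: reach_in ws.
  exact: reach_in ws'.
have [_ Pw _ _] := ew; have [_ Pw' _ _] := ew'.
have [t wt] := reach_exists Pw Fw; have [t' w't'] := reach_exists Pw' Fw'.
have tt' := two_face_sink kF (reach_end wt) (reach_end w't'); subst t'.
have [Pt [Ft _]] := reach_end wt.
(* The sink [t] of [F] may have out-neighbors in [G]; a continuation to a sink [s''] of [G] is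
   compared by induction with [s] from [w] and with [s'] from [w']. *)
have [s'' ts''] := reach_exists Pt (FG _ Ft).
rewrite (IH w s s'' _ ws (reach_trans FG wt ts'')) ?lt_w //.
by rewrite (IH w' s' s'' _ ws' (reach_trans FG w't' ts'')) ?lt_w.
Qed.

Lemma face_sink_unique G u v : face P G -> sink P O G u -> sink P O G v -> u = v.
Proof.
move=> fG su sv; apply: (reach_from_sink sv).
(* Reaching [u] passes along edges of [G] in both directions, so [v] reaches [u] as well. *)
apply: (face_connected polytopeP simpleP (Q := fun x => reach G x u) fG su.1 su.2.1).
- exact: reach_sink.
- move=> x w exw Gx Gw xu; have [_ Pw _ _] := exw.
  have := orientationO.2 _ _ exw; case: (boolP (O x w)) => [xw _|_ /= wx].
    have [s ws] := reach_exists Pw Gw.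
    by rewrite (reach_unique fG xu (reach_step Gx xw ws)).
  exact: reach_step wx xu.
- exact: sv.1.
exact: sv.2.1.
Qed.

End UniqueSinks.

Lemma f2_H2 : acyclic O ->
  (f_ 2 P <= H2 P d O)%N /\ (f_ 2 P = H2 P d O <-> AOF_orientation P O).
Proof.
move=> acyclicO; have [vs uvs vsE] := vertices_enum polytopeP.
have [fs ufs fsE] := two_faces_enum polytopeP.
have [phi num OE] := acyclic_numbering acyclicO.
have phi_lt u v : O u v -> (phi v < phi u)%N by rewrite OE => /andP[].
have phi_ltR u v : O u v -> (phi v)%:R < (phi u)%:R :> R.
  by move=> /phi_lt; rewrite ltr_nat.
have f2E : f_ 2 P = size fs by apply: ncardE.
rewrite f2E (H2_sinks polytopeP simpleP orientationO uvs vsE ufs fsE).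
have [F /fsE kF|le_f eq_f] := @leq_size_sum _ fs (fun F => count (fun v => `[<sink P O F v>]) vs).
  have [v sv] := sink_exists polytopeP orientationO phi_ltR kF.1 (has_dim_inhabited kF.2).
  rewrite -has_count; apply/hasP; exists v; first exact/vsE/sv.1.
  exact/asboolP.
split => //; apply: iff_trans eq_f _; split => [H|].
  exists phi => //; split => // F fF F0.
  have [v sv] := sink_exists polytopeP orientationO phi_ltR fF F0.
  have OE' : induced_orientation P phi = O by apply/funext => x; apply/funext => y.
  rewrite OE'; exists v; split => // w sw.
  apply: face_sink_unique phi_lt _ _ _ _ fF sv sw => G x y /fsE kG sx sy.
  have [z zs [_ zuniq]] := (count_eq1 _ uvs).1 (H G kG).
  have xz : x = z by apply: zuniq; [exact/vsE/sx.1|exact/asboolP].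
  have yz : y = z by apply: zuniq; [exact/vsE/sy.1|exact/asboolP].
  by rewrite xz yz.
move=> [psi [_ aof] OE2] F /fsE kF; apply/count_eq1 => //.
have OE' : induced_orientation P psi = O by apply/funext => x; apply/funext => y.
have [v [sv vuniq]] := aof F kF.1 (has_dim_inhabited kF.2).
rewrite OE' in sv vuniq; exists v; first exact/vsE/sv.1.
split; first exact/asboolP.
by move=> w _ /asboolP sw; rewrite (vuniq w sw).
Qed.
End Orientations.

(** * Closed walks *)

Lemma pi_dihedral (T : choiceType) (s t : seq T) : dihedral_rel s t ->
  \pi_(cyc_seq T)%qT s = \pi_(cyc_seq T)%qT t.
Proof. by move=> st; apply/eqmodP. Qed.

Lemma repr_dihedral (T : choiceType) (s : seq T) :
  dihedral_rel (repr (\pi_(cyc_seq T)%qT s)) s.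
Proof. by apply/(@eqmodP _ (@dihedral_equiv T)); rewrite reprK. Qed.

Lemma uniq_pairs (T U : eqType) (s : seq T) (t : T -> seq U) :
  uniq s -> (forall x, uniq (t x)) -> uniq [seq (x, y) | x <- s, y <- t x].
Proof.
move=> + ut; elim: s => //= x s IH /andP[xs us].
rewrite cat_uniq map_inj_uniq ?ut ?IH ?andbT //=; last by move=> y z [].
apply/hasPn => z /allpairsPdep[x' [y [x's _ ->]]].
by apply/mapP => -[y' _ [E _]]; rewrite -E x's in xs.
Qed.

Lemma size_pairs (T U : eqType) (s : seq T) (t : T -> seq U) :
  size [seq (x, y) | x <- s, y <- t x] = (\sum_(x <- s) size (t x))%N.
Proof. by rewrite size_allpairs_dep sumnE big_map. Qed.

(** * Positions on cyclic sequences *)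

Section CyclicPositions.
Local Open Scope ring_scope.
Variables (R : realType) (n : nat).
Implicit Types (w : seq 'rV[R]_n).

Lemma at_pos_mod w i : at_pos w (i %% size w) = at_pos w i.
Proof. by rewrite /at_pos modn_mod. Qed.

Lemma at_pos_addn w i : at_pos w (i + size w) = at_pos w i.
Proof. by rewrite /at_pos modnDr. Qed.

Lemma at_pos_nth w i : (i < size w)%N -> at_pos w i = w`_i.
Proof. by move=> iw; rewrite /at_pos modn_small. Qed.

Lemma at_pos_mem w i : (0 < size w)%N -> at_pos w i \in w.
Proof. by move=> w0; rewrite mem_nth // ltn_mod. Qed.

Lemma mem_at_pos w x : x \in w -> exists2 i, (i < size w)%N & at_pos w i = x.
Proof.
move=> xw; have iw : (index x w < size w)%N by rewrite index_mem.
by exists (index x w); rewrite // at_pos_nth // nth_index.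
Qed.

Lemma next_pos_mod w i : next_pos w (i %% size w) = next_pos w i.
Proof. by rewrite /next_pos /at_pos -[(_ %% _).+1]addn1 modnDml addn1. Qed.

Lemma prev_pos_mod w i : prev_pos w (i %% size w) = prev_pos w i.
Proof. by rewrite /prev_pos /at_pos modnDml. Qed.

Lemma next_prev_index w i : (0 < size w)%N ->
  at_pos w (i + (size w).-1).+1 = at_pos w i.
Proof. by move=> w0; rewrite -addnS prednK // at_pos_addn. Qed.

Lemma prev_posS w i : (0 < size w)%N -> prev_pos w i.+1 = at_pos w i.
Proof. by move=> w0; rewrite /prev_pos addSn next_prev_index. Qed.

(** A rotation by at least the size is the identity, and the shift by [size w] given by [minn] is
    then invisible modulo the size. *)
Lemma at_pos_rot w k i : at_pos (rot k w) i = at_pos w (i + minn k (size w)).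
Proof.
have [w0|] := posnP (size w); first by rewrite (size0nil w0) /at_pos !nth_nil.
move=> w0; have [kw|wk] := leqP (size w) k.
  by rewrite rot_oversize // at_pos_addn.
rewrite /at_pos size_rot /rot nth_cat size_drop -modnDml.
move: (ltn_pmod i w0); move: (i %% _)%N => m.
move: (size _) w0 wk => N w0 wk mN; case: ltnP => mk.
  by rewrite nth_drop modn_small 1?addnC //; lia.
rewrite nth_take; last by lia.
congr (w`_ _); have -> : (m + k = m - (N - k) + N)%N by lia.
by rewrite modnDr modn_small //; lia.
Qed.

Lemma at_pos_rev w i : (i < size w)%N -> at_pos (rev w) i = at_pos w ((size w).-1 - i).
Proof.
move=> iw; have [lt_iw E] : ((size w).-1 - i < size w /\ (size w).-1 - i = size w - i.+1)%N.
  by move: (size w) iw => N; lia.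
by rewrite !at_pos_nth ?size_rev // nth_rev // E.
Qed.

End CyclicPositions.

(** * Boundary cycles of 2-faces and their uniqueness *)

Section BoundaryCycles.
Local Open Scope ring_scope.
Local Open Scope classical_set_scope.
Variables (R : realType) (n d : nat) (P : set 'rV[R]_n).
Hypotheses (polytopeP : polytope P) (simpleP : simple P d).
Implicit Types (F G : set 'rV[R]_n) (u v x a b : 'rV[R]_n) (w : seq 'rV[R]_n).

Lemma walk_edges w i : closed_smooth_walk P w ->
  [/\ edge P (at_pos w i) (next_pos w i), edge P (at_pos w i) (prev_pos w i) &
      prev_pos w i <> next_pos w i].
Proof.
move=> [w3 ws]; have w0 : (0 < size w)%N by apply: leq_trans w3.
have H j := ws (j %% size w)%N (ltn_pmod j w0).
split.
- by have [] := H i; rewrite at_pos_mod next_pos_mod.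
- apply: edge_sym; have [] := H (i + (size w).-1)%N.
  by rewrite at_pos_mod next_pos_mod /next_pos next_prev_index.
by have [] := H i; rewrite prev_pos_mod next_pos_mod.
Qed.

(** A vertex of a polygon has two neighbors only. This determines how a walk inside [F]
    continues. *)
Lemma two_face_third_neighbor F v a b x : kface P 2 F -> edge P v a -> edge P v b ->
  edge P v x -> F v -> F a -> F b -> F x -> a <> b -> x <> a -> x = b.
Proof.
move=> kF va vb vx Fv Fa Fb Fx ab xa; have [Pv _ _ _] := va.
have [a' [b' [_ _ _ H]]] := two_face_neighbors polytopeP simpleP kF Pv Fv.
have := H a va Fa; have := H b vb Fb; have := H x vx Fx.
by move=> [E1|E1] [E2|E2] [E3|E3]; subst.
Qed.

Lemma boundary_cycle_walk F w : boundary_cycle P F w -> closed_smooth_walk P w.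
Proof.
move=> [w3 uw _ we]; split => // i iw; split; first exact: we.
rewrite /prev_pos /next_pos /at_pos => /eqP; rewrite nth_uniq //; last 2 first.
- by rewrite ltn_mod; apply: leq_trans w3.
- by rewrite ltn_mod; apply: leq_trans w3.
move: (size w) w3 iw => N N3 iN /eqP.
(* The predecessor is [N - 2] positions after the successor, which is not 0 modulo [N] as [N] is at
   least 3. *)
have -> : (i + N.-1 = i.+1 + (N - 2))%N by lia.
rewrite -[X in _ = (X %% _)%N]addn0 => /eqP.
by rewrite eqn_modDl mod0n modn_small; lia.
Qed.

Lemma boundary_cycle_face F w i : boundary_cycle P F w ->
  vertices P (at_pos w i) /\ F (at_pos w i).
Proof. by move=> [w3 _ wF _]; apply/wF/at_pos_mem; apply: leq_trans w3. Qed.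

(** Within [F] the node [v] has only the neighbors [a] and [b], so a smooth walk enters by one and
    leaves by the other. *)
Lemma walk_passes F w i v a b : kface P 2 F -> closed_smooth_walk P w ->
    (i < size w)%N -> (forall j, F (at_pos w j)) ->
    at_pos w i = v -> edge P v a -> edge P v b -> a <> b -> F a -> F b ->
  passes w i a v b.
Proof.
move=> kF cw iw wF <- va vb ab Fa Fb; split => //.
have [en ep pn] := walk_edges i cw.
have Fi : F (at_pos w i) by [].
have Fn : F (next_pos w i) by apply: wF.
have Fp : F (prev_pos w i) by apply: wF.
have [E|pa] := pselect (prev_pos w i = a).
  left; rewrite E; congr (_, _, _).
  by apply: (two_face_third_neighbor kF va vb en) => // nE; case: pn; rewrite E.
right; have pb : prev_pos w i = b by apply: (two_face_third_neighbor kF va vb ep).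
rewrite pb; congr (_, _, _).
apply: (two_face_third_neighbor kF vb va en) => //; first exact: nesym.
by move=> nE; case: pn; rewrite pb.
Qed.

Lemma boundary_cycle_passes F w v a b : kface P 2 F -> boundary_cycle P F w ->
  edge P v a -> edge P v b -> a <> b -> F v -> F a -> F b ->
  exists i, passes w i a v b.
Proof.
move=> kF bF va vb ab Fv Fa Fb; have [Pv _ _ _] := va.
have [w3 _ wF _] := bF; have /mem_at_pos[i iw iv] := (wF v).2 (conj Pv Fv).
exists i; apply: (walk_passes kF (boundary_cycle_walk bF)) => //.
by move=> j; have [] := boundary_cycle_face j bF.
Qed.

Lemma boundary_cycle_rot F w k : boundary_cycle P F w -> boundary_cycle P F (rot k w).
Proof.
move=> bF; have [w3 uw wF we] := bF.
split; rewrite ?size_rot ?rot_uniq //; first by move=> v; rewrite mem_rot.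
move=> i iw.
rewrite /next_pos !at_pos_rot addSn.
by have [] := walk_edges (i + minn k (size w)) (boundary_cycle_walk bF).
Qed.

Lemma boundary_cycle_rev F w : boundary_cycle P F w -> boundary_cycle P F (rev w).
Proof.
move=> bF; have [w3 uw wF we] := bF.
have w0 : (0 < size w)%N by apply: leq_trans w3.
split; rewrite ?size_rev ?rev_uniq //; first by move=> v; rewrite mem_rev.
move=> i iw.
rewrite /next_pos at_pos_rev //; have cw := boundary_cycle_walk bF.
(* The last position of the reversed cycle wraps around to its first node, the last node of [w]. *)
have [E|ne] := eqVneq i.+1 (size w).
  have -> : at_pos (rev w) i.+1 = at_pos (rev w) 0.
    by rewrite -[RHS]at_pos_addn size_rev add0n E.
  rewrite at_pos_rev // -E subnn subn0.
  have [_ + _] := walk_edges 0 cw.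
  by rewrite /prev_pos add0n -[in (size w).-1]E.
have iw' : (i.+1 < size w)%N by rewrite ltn_neqAle ne.
rewrite at_pos_rev //.
have -> : ((size w).-1 - i = ((size w).-1 - i.+1).+1)%N.
  by move: (size w) iw' => N; lia.
have [_ + _] := walk_edges ((size w).-1 - i.+1).+1 cw.
by rewrite prev_posS.
Qed.

Lemma boundary_cycle_dihedral F w w' : dihedral_rel w w' ->
  boundary_cycle P F w' -> boundary_cycle P F w.
Proof.
move=> /asboolP[k [->|->]] bF; first exact: boundary_cycle_rot.
exact/boundary_cycle_rot/boundary_cycle_rev.
Qed.

(** The next node is the neighbor in [F] other than the previous one, so agreement at two
    consecutive positions propagates. *)
Lemma boundary_cycle_determined F w w' : kface P 2 F ->
    boundary_cycle P F w -> boundary_cycle P F w' ->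
  at_pos w 0 = at_pos w' 0 -> at_pos w 1 = at_pos w' 1 -> w = w'.
Proof.
move=> kF bF bF' E0 E1; have [w3 uw wF _] := bF; have [w'3 uw' wF' _] := bF'.
have sz : size w = size w'.
  by apply: perm_size; apply: uniq_perm => // x; apply/idP/idP => [/wF/wF'|/wF'/wF].
have w0 : (0 < size w)%N by apply: leq_trans w3.
have w'0 : (0 < size w')%N by rewrite -sz.
have H k : at_pos w k = at_pos w' k /\ at_pos w k.+1 = at_pos w' k.+1.
  elim: k => // k [IH1 IH2]; split => //.
  have [en ep pn] := walk_edges k.+1 (boundary_cycle_walk bF).
  have [en' ep' pn'] := walk_edges k.+1 (boundary_cycle_walk bF').
  rewrite !prev_posS // in en ep pn en' ep' pn'; rewrite /next_pos in en pn en' pn'.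
  rewrite -IH2 -IH1 in en' ep' pn'.
  have Fw i : F (at_pos w i) by have [] := boundary_cycle_face i bF.
  have Fw' i : F (at_pos w' i) by have [] := boundary_cycle_face i bF'.
  by apply: (two_face_third_neighbor kF ep' en' en) => //; apply: nesym.
apply: (@eq_from_nth _ 0) => // i iw.
by have [+ _] := H i; rewrite (at_pos_nth iw) at_pos_nth // -sz.
Qed.

(** After a rotation both cycles start at the same node. It has two neighbors in [F], so the second
    nodes agree either directly or after a reversal. *)
Lemma boundary_cycle_unique F w w' : kface P 2 F ->
  boundary_cycle P F w -> boundary_cycle P F w' -> dihedral_rel w w'.
Proof.
move=> kF bF bF'; have [w3 uw wF _] := bF; have [w'3 uw' wF' _] := bF'.
have w0 : (0 < size w)%N by apply: leq_trans w3.
have [k kw' kE] : exists2 k, (k < size w')%N & at_pos w' k = at_pos w 0.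
  by apply: mem_at_pos; apply/wF'; apply: boundary_cycle_face.
pose w1 := rot k w'; have bF1 : boundary_cycle P F w1 by apply: boundary_cycle_rot.
have dih1 : dihedral_rel w1 w' by apply/asboolP; exists k; left.
have w10 : at_pos w1 0 = at_pos w 0.
  by rewrite at_pos_rot add0n (minn_idPl (ltnW kw')).
have w1_gt0 : (0 < size w1)%N by rewrite size_rot; apply: leq_trans w'3.
have Fw i : F (at_pos w i) by have [] := boundary_cycle_face i bF.
have Fw1 i : F (at_pos w1 i) by have [] := boundary_cycle_face i bF1.
have [en ep pn] := walk_edges 0 (boundary_cycle_walk bF).
have [en1 ep1 pn1] := walk_edges 0 (boundary_cycle_walk bF1).
rewrite w10 in en1 ep1.
have [E|ne] := pselect (at_pos w 1 = at_pos w1 1).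
  by rewrite (boundary_cycle_determined kF bF bF1).
(* This rotation brings the starting node, which is last in the reversal, back to position 0. *)
pose w2 := rot (size w1).-1 (rev w1).
have dih2 : dihedral_rel w2 w1 by apply/asboolP; exists (size w1).-1; right.
have bF2 : boundary_cycle P F w2 by apply: boundary_cycle_dihedral dih2 bF1.
have rotE : minn (size w1).-1 (size (rev w1)) = (size w1).-1.
  by rewrite size_rev; apply/minn_idPl/leq_pred.
rewrite (boundary_cycle_determined kF bF bF2).
- exact: dihedral_rel_trans dih2 dih1.
- by rewrite at_pos_rot rotE add0n at_pos_rev ?prednK // subnn w10.
rewrite at_pos_rot rotE add1n prednK // -[size w1]size_rev -[size (rev w1)]add0n.
rewrite at_pos_addn at_pos_rev // subn0.
have -> : at_pos w1 (size w1).-1 = prev_pos w1 0 by [].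
by apply: (two_face_third_neighbor kF en1 ep1 en);
  do ?[exact: Fw|exact: Fw1|exact: nesym].
Qed.
End BoundaryCycles.

(** * Facoidal systems and their sink positions *)

Section FacoidalSystems.
Local Open Scope ring_scope.
Local Open Scope classical_set_scope.
Variables (R : realType) (n d : nat) (P : set 'rV[R]_n).
Hypotheses (polytopeP : polytope P) (simpleP : simple P d).
Variable W : set (cyc_seq 'rV[R]_n).
Hypothesis facoidalW : facoidal P W.
Implicit Types (F G : set 'rV[R]_n) (u v x a b : 'rV[R]_n) (w : seq 'rV[R]_n).
Implicit Types (C : cyc_seq 'rV[R]_n) (O : rel 'rV[R]_n).

Lemma facoidal_walk C : W C -> closed_smooth_walk P (repr C).
Proof. exact: facoidalW.1. Qed.

Lemma facoidal_exists v a b : edge P v a -> edge P v b -> a <> b ->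
  exists C i, W C /\ passes (repr C) i a v b.
Proof.
by move=> va vb ab; have [[C i] [[WC Ci] _]] := facoidalW.2 v a b va vb ab; exists C, i.
Qed.

Lemma facoidal_unique v a b C C' i i' : edge P v a -> edge P v b -> a <> b ->
  W C -> passes (repr C) i a v b -> W C' -> passes (repr C') i' a v b ->
  C = C' /\ i = i'.
Proof.
move=> va vb ab WC Ci WC' Ci'; have [p [_ up]] := facoidalW.2 v a b va vb ab.
have E : (C, i) = (C', i') by rewrite -(up (C, i) (conj WC Ci)) -(up (C', i') (conj WC' Ci')).
by case: E.
Qed.

Lemma walk_nonempty C : W C -> (0 < size (repr C))%N.
Proof. by move=> /facoidal_walk[+ _]; apply: leq_trans. Qed.

(** A walk of [W] is determined by the triple of nodes around its position 0, so finitely many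
    triples of vertices cover [W]. *)
Lemma facoidal_enum : exists2 ws, uniq ws & forall C, W C <-> C \in ws.
Proof.
apply: finite_enum; have [vs _ vsE] := vertices_enum polytopeP.
pose Q (t : 'rV[R]_n * 'rV[R]_n * 'rV[R]_n) C := W C /\ passes (repr C) 0 t.1.1 t.1.2 t.2.
have [g gP] : exists g, forall t, (exists C, Q t C) -> Q t (g t).
  have H t : exists C, (exists C, Q t C) -> Q t C.
    have [[C QC]|N] := pselect (exists C, Q t C); first by exists C.
    (* The empty walk is a default for triples that no walk has at position 0. *)
    by exists (\pi_(cyc_seq 'rV[R]_n)%qT [::]) => /N.
  by have [g gP] := choice H; exists g.
pose D2 := [seq (x, y) | x : 'rV[R]_n <- vs, y : 'rV[R]_n <- vs].
pose D := [seq (x, y) | x : ('rV[R]_n * 'rV[R]_n)%type <- D2, y : 'rV[R]_n <- vs].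
apply: (@sub_finite_set _ _ (g @` [set` D])); last exact/finite_image/finite_seq.
move=> C WC; have cw := facoidal_walk WC.
have [en ep pn] := walk_edges 0 cw.
have [/vsE v0 /vsE vn _ _] := en; have [_ /vsE vp _ _] := ep.
pose t := (prev_pos (repr C) 0, at_pos (repr C) 0, next_pos (repr C) 0); exists t.
  apply/allpairsP; exists t; split => //.
  by apply/allpairsP; exists t.1.
have QC : Q t C by split => //; split; [exact: walk_nonempty|left].
have [WD Dp] := gP t (ex_intro _ C QC).
by have [] := facoidal_unique ep en pn WD Dp WC QC.2.
Qed.

Definition sink_position O w i : bool :=
  O (prev_pos w i) (at_pos w i) && O (next_pos w i) (at_pos w i).

(* Both sides count the pairs of edges entering a common vertex: such a pair
   determines a position of a walk, and it spans a 2-face. *)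
Lemma sink_positions O vs fs ws : orientation P O ->
    uniq vs -> (forall v, vertices P v <-> v \in vs) ->
    uniq fs -> (forall F, kface P 2 F <-> F \in fs) ->
    uniq ws -> (forall C, W C <-> C \in ws) ->
  (\sum_(C <- ws) count (sink_position O (repr C)) (iota 0 (size (repr C))) =
   \sum_(F <- fs) count (fun v => `[<sink P O F v>]) vs)%N.
Proof.
move=> oO uvs vsE ufs fsE uws wsE.
under eq_bigr do rewrite -size_filter; rewrite -size_pairs.
under eq_bigr do rewrite -size_filter; rewrite -size_pairs.
set A := [seq _ | _ <- ws, _ <- _]; set B := [seq _ | _ <- fs, _ <- _].
have uA : uniq A by apply: uniq_pairs => // C; apply/filter_uniq/iota_uniq.
have uB : uniq B by apply: uniq_pairs => // F; apply/filter_uniq.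
have AE C i : (C, i) \in A <->
    [/\ W C, (i < size (repr C))%N & sink_position O (repr C) i].
  split.
    move=> /allpairsPdep[C' [i' [/wsE WC + [-> ->]]]].
    by rewrite mem_filter mem_iota add0n => /andP[? ?].
  move=> [WC iC si]; apply/allpairsPdep; exists C, i; split => //; first exact/wsE.
  by rewrite mem_filter mem_iota si.
have BE F v : (F, v) \in B <-> kface P 2 F /\ sink P O F v.
  split.
    move=> /allpairsPdep[F' [v' [/fsE kF + [-> ->]]]].
    by rewrite mem_filter => /andP[/asboolP ? _].
  move=> [kF sv]; apply/allpairsPdep; exists F, v; split => //; first exact/fsE.
  rewrite mem_filter; apply/andP; split; first exact/asboolP.
  exact/vsE/sv.1.
pose r (p : cyc_seq 'rV[R]_n * nat) (q : set 'rV[R]_n * 'rV[R]_n) :=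
  [/\ at_pos (repr p.1) p.2 = q.2, q.1 (prev_pos (repr p.1) p.2) &
      q.1 (next_pos (repr p.1) p.2)].
have O_sink F v a : sink P O F v -> edge P v a -> F a -> O a v.
  move=> [_ [_ sv]] /oO.2 + Fa; have := sv a Fa; by case: (O v a) => //= _ ->.
apply/eqP; rewrite eqn_leq; apply/andP; split.
  (* The two edges at a sink position span a 2-face with that sink; two positions giving the same
     2-face and sink coincide by facoidal uniqueness. *)
  apply: (@leq_size_rel _ _ _ _ r) => //.
    move=> [C i] /AE[WC iC /andP[si si']].
    have [en ep pn] := walk_edges i (facoidal_walk WC).
    have [F [kF Fv Fp Fn]] := two_face_exists polytopeP simpleP ep en pn.
    exists (F, at_pos (repr C) i) => //; apply/BE; split => //.
    have [Pv _ _ _] := en; do 2!split => //; move=> u Fu; apply/negP => vu.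
    have [E|/nesym pu] := pselect (prev_pos (repr C) i = u).
      by have := oO.2 _ _ ep; rewrite si E vu.
    have E := two_face_third_neighbor polytopeP simpleP kF ep en (oO.1 _ _ vu)
      Fv Fp Fn Fu pn pu.
    by have := oO.2 _ _ en; rewrite si' -E vu.
  move=> [C i] [C' i'] [F v] /AE[WC iC _] /AE[WC' iC' _] /BE[kF sv].
  rewrite /r /=; case => vE Fp Fn [vE' Fp' Fn'].
  have [en ep pn] := walk_edges i (facoidal_walk WC).
  have [en' ep' pn'] := walk_edges i' (facoidal_walk WC').
  have Fv := sv.2.1; rewrite vE in en ep; rewrite vE' in en' ep'.
  have [pi_ pi'] : passes (repr C) i (prev_pos (repr C) i) v (next_pos (repr C) i) /\
      passes (repr C') i' (prev_pos (repr C) i) v (next_pos (repr C) i).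
    split; first by split => //; left; rewrite vE.
    split => //; rewrite vE'.
    have [E|pp] := pselect (prev_pos (repr C') i' = prev_pos (repr C) i).
      left; congr (_, _, _) => //.
      apply: (two_face_third_neighbor polytopeP simpleP kF ep en en') => //.
      by rewrite -E; apply: nesym.
    right; have E : prev_pos (repr C') i' = next_pos (repr C) i.
      exact: (two_face_third_neighbor polytopeP simpleP kF ep en ep').
    congr (_, _, _) => //.
    apply: (two_face_third_neighbor polytopeP simpleP kF en ep en') => //.
      exact: nesym.
    by rewrite -E; apply: nesym.
  by have [-> ->] := facoidal_unique ep en pn WC pi_ WC' pi'.
(* Conversely, the two edges of [F] at its sink are consecutive in some walk of [W], and they
   determine [F]. *)
apply: (@leq_size_rel _ _ _ _ (fun q p => r p q)) => //.
  move=> [F v] /BE[kF sv]; have [Pv [Fv _]] := sv.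
  have [a [b [ab [va Fa] [vb Fb] _]]] := two_face_neighbors polytopeP simpleP kF Pv Fv.
  have [C [i [WC [iC Ci]]]] := facoidal_exists va vb ab.
  have Oa := O_sink _ _ _ sv va Fa; have Ob := O_sink _ _ _ sv vb Fb.
  exists (C, i); last by rewrite /r /=; case: Ci => -[-> -> ->].
  by apply/AE; split => //; rewrite /sink_position; case: Ci => -[-> -> ->]; rewrite Oa Ob.
move=> [F v] [F' v'] [C i] /BE[kF sv] /BE[kF' sv'] /AE[WC iC _].
rewrite /r /=; case => vE Fp Fn [vE' Fp' Fn'].
have [en ep pn] := walk_edges i (facoidal_walk WC).
rewrite vE in en ep vE'; rewrite -vE' in sv' *; congr (_, _).
have [Fv F'v] := (sv.2.1, sv'.2.1).
by apply: (two_face_unique polytopeP simpleP kF kF' ep en pn).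
Qed.

Lemma walk_min C (f : 'rV[R]_n -> R) : W C -> exists2 i, (i < size (repr C))%N &
  forall j, f (at_pos (repr C) i) <= f (at_pos (repr C) j).
Proof.
move=> WC; have w0 := walk_nonempty WC.
have [|x xw xmin] := seq_argmax (fun x => - f x) (x0 := at_pos (repr C) 0) (s := repr C).
  exact: at_pos_mem.
have [i iC iE] := mem_at_pos xw; exists i => // j.
by rewrite iE -lerN2; apply/xmin/at_pos_mem.
Qed.

Lemma min_sink_position C h i : separates P h -> W C ->
  (forall j, ev h (at_pos (repr C) i) <= ev h (at_pos (repr C) j)) ->
  sink_position (linear_orientation P h) (repr C) i.
Proof.
move=> hsep WC imin; have [en ep _] := walk_edges i (facoidal_walk WC).
have lt j : edge P (at_pos (repr C) i) (at_pos (repr C) j) ->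
    linear_orientation P h (at_pos (repr C) j) (at_pos (repr C) i).
  move=> e; have [Pu Pv ne _] := e.
  rewrite /linear_orientation (asboolT (edge_sym e)) /= lt_neqAle imin andbT.
  exact/eqP/hsep.
by apply/andP; split; apply: lt.
Qed.

Lemma linear_sinks h vs fs : separates P h ->
    uniq vs -> (forall v, vertices P v <-> v \in vs) ->
    (forall F, kface P 2 F <-> F \in fs) ->
  (\sum_(F <- fs) count (fun v => `[<sink P (linear_orientation P h) F v>]) vs)%N =
  size fs.
Proof.
move=> hsep uvs vsE fsE; rewrite -sum1_size big_seq [RHS]big_seq.
apply: eq_bigr => F /fsE kF; apply/count_eq1 => //.
have [|v sv] := sink_exists (f := ev h) polytopeP (linear_orientationP hsep) _
  kF.1 (has_dim_inhabited kF.2); first by move=> u v /andP[].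
exists v; first exact/vsE/sv.1; split; first exact/asboolP.
move=> u _ /asboolP su; exact: (linear_sink_unique polytopeP simpleP hsep kF.1).
Qed.

(** Under a generic functional every 2-face has one sink and every walk has a sink position at its
    minimum. If the counts agree, no walk has room for a second one. *)
Lemma facoidal_sinks h : separates P h -> (ncard W <= f_ 2 P)%N /\
  (ncard W = f_ 2 P -> forall C i j, W C ->
    (i < size (repr C))%N -> (j < size (repr C))%N ->
    sink_position (linear_orientation P h) (repr C) i ->
    sink_position (linear_orientation P h) (repr C) j -> i = j).
Proof.
move=> hsep; have [vs uvs vsE] := vertices_enum polytopeP.
have [fs ufs fsE] := two_faces_enum polytopeP; have [ws uws wsE] := facoidal_enum.
rewrite (ncardE uws wsE) (_ : f_ 2 P = size fs); last exact: ncardE.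
have := sink_positions (linear_orientationP hsep) uvs vsE ufs fsE uws wsE.
rewrite (linear_sinks hsep uvs vsE fsE) => <-.
have [|le_w eq_w] := @leq_size_sum _ ws (fun C =>
  count (sink_position (linear_orientation P h) (repr C)) (iota 0 (size (repr C)))).
  move=> C /wsE WC; have [i iC imin] := walk_min (ev h) WC.
  rewrite -has_count; apply/hasP; exists i; first by rewrite mem_iota.
  exact: min_sink_position imin.
split => // /eq_w H C i j /wsE WC iC jC si sj.
have /count_eq1[|k _ [_ kuniq]] := H C WC; first exact: iota_uniq.
by transitivity k; [|apply: esym]; apply: kuniq; rewrite ?mem_iota.
Qed.

(* Orient by a generic linear functional that is larger on F than elsewhere,
   and take the walk through the sink of F in F. The minimum of the functional
   on this walk is its only sink position, so the walk cannot leave F. *)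
Lemma boundary_in_facoidal F : ncard W = f_ 2 P -> kface P 2 F ->
  exists2 C, W C & boundary_cycle P F (repr C).
Proof.
move=> eqW kF; have [h hsep htop] := top_functional polytopeP kF.1.
have oO := linear_orientationP hsep.
have [|s ss] := sink_exists (f := ev h) polytopeP oO _ kF.1 (has_dim_inhabited kF.2).
  by move=> u v /andP[].
have [Ps [Fs _]] := ss.
have [a [b [ab [sa Fa] [sb Fb] _]]] := two_face_neighbors polytopeP simpleP kF Ps Fs.
have Os x : edge P s x -> F x -> linear_orientation P h x s.
  move=> /oO.2 + Fx; have := ss.2.2 x Fx.
  by case: (linear_orientation P h s x) => //= _ ->.
have [C [i [WC [iC Ci]]]] := facoidal_exists sa sb ab; exists C => //.
set w := repr C in iC Ci *; have cw : closed_smooth_walk P w := facoidal_walk WC.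
have w0 : (0 < size w)%N := walk_nonempty WC.
have si : sink_position (linear_orientation P h) w i.
  by rewrite /sink_position; case: Ci => -[-> -> ->]; rewrite !Os.
have [m mw mmin] := walk_min (ev h) WC.
have mi : m = i.
  by apply: ((facoidal_sinks hsep).2 eqW C m i) => //; apply: min_sink_position.
have Pw j : vertices P (at_pos w j) by have [[]] := walk_edges j cw.
(* By [mi] the node [s] is minimal on the walk, whereas vertices outside [F] have smaller values
   than [s]. *)
have Fw j : F (at_pos w j).
  apply: contrapT => NF; have := mmin j; rewrite mi leNgt => /negP; apply.
  apply: htop => //; by case: Ci => -[_ -> _].
have nbrs j x : edge P (at_pos w j) x -> F x -> x = prev_pos w j \/ x = next_pos w j.
  move=> ex Fx; have [en ep pn] := walk_edges j cw.
  have [|np] := pselect (x = prev_pos w j); [by left|right].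
  by apply: (two_face_third_neighbor polytopeP simpleP kF ep en ex) => //; apply: Fw.
split; first exact: cw.1.
(* At a repeated node the walk would pass twice through the only pair of edges of [F] there, which
   facoidal uniqueness excludes. *)
- apply/(uniqP 0) => j k; rewrite !inE => jw kw; rewrite -!at_pos_nth // => jk.
  have [en ep pn] := walk_edges j cw.
  have pj : passes w j (prev_pos w j) (at_pos w j) (next_pos w j) by split => //; left.
  have pk : passes w k (prev_pos w j) (at_pos w j) (next_pos w j).
    by apply: (walk_passes polytopeP simpleP kF cw kw Fw) => //; apply: Fw.
  by have [] := facoidal_unique ep en pn WC pj WC pk.
- move=> v; split=> [/mem_at_pos[j _ <-]//|[Pv Fv]].
  (* The nodes of the walk are closed under the edges of the connected face [F], so all its vertices
     are visited. *)
  apply: (face_connected polytopeP simpleP (Q := fun x => x \in w) kF.1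
    (Pw 0%N) (Fw 0%N) _ _ Pv Fv).
    exact: at_pos_mem.
  move=> u x ux Fu Fx /mem_at_pos[j _ uE]; rewrite -uE in ux.
  by case: (nbrs j x ux Fx) => ->; apply: at_pos_mem.
by move=> j _; have [] := walk_edges j cw.
Qed.

(** Two consecutive edges of a walk span a 2-face whose boundary belongs to [W] and passes through
    the same edges, so uniqueness identifies it with the walk. *)
Lemma facoidal_F2 : ncard W = f_ 2 P -> W = F2 P.
Proof.
move=> eqW; apply/seteqP; split => C.
  move=> WC; have [en ep pn] := walk_edges 0 (facoidal_walk WC).
  have [F [kF Fv Fp Fn]] := two_face_exists polytopeP simpleP ep en pn.
  have [C' WC' bF] := boundary_in_facoidal eqW kF.
  have [i pi'] := boundary_cycle_passes polytopeP simpleP kF bF ep en pn Fv Fp Fn.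
  have pC : passes (repr C) 0 (prev_pos (repr C) 0) (at_pos (repr C) 0) (next_pos (repr C) 0).
    by split; [exact: walk_nonempty|left].
  have [-> _] := facoidal_unique ep en pn WC pC WC' pi'.
  by exists F => //; exists (repr C') => //; rewrite reprK.
move=> [F kF [w bw ->]]; have [C' WC' bF] := boundary_in_facoidal eqW kF.
by rewrite (pi_dihedral (boundary_cycle_unique polytopeP simpleP kF bw bF)) reprK.
Qed.

(** The walk through two edges of [F] at a vertex bounds some 2-face [F'] containing both edges,
    hence [F] itself. Thus the facoidal property provides each 2-face with a boundary cycle in [W],
    and distinct 2-faces with distinct ones. *)
Lemma F2_facoidal_card : W = F2 P -> (f_ 2 P <= ncard W)%N.
Proof.
move=> WE; have [fs ufs fsE] := two_faces_enum polytopeP.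
have [ws uws wsE] := facoidal_enum.
rewrite (ncardE uws wsE) (_ : f_ 2 P = size fs); last exact: ncardE.
apply: (@leq_size_rel _ _ _ _ (fun F C => boundary_cycle P F (repr C))) => //.
  move=> F /fsE kF.
  have [v Pv Fv] := face_has_vertex polytopeP kF.1 (has_dim_inhabited kF.2).
  have [a [b [ab [va Fa] [vb Fb] _]]] := two_face_neighbors polytopeP simpleP kF Pv Fv.
  have [C [i [WC [iC Ci]]]] := facoidal_exists va vb ab.
  have [F' kF' bF'] : exists2 F', kface P 2 F' & boundary_cycle P F' (repr C).
    have [F' kF' [w bw CE]] : F2 P C by rewrite -WE.
    exists F' => //; apply: (boundary_cycle_dihedral _ bw).
    rewrite CE; exact: repr_dihedral.
  exists C; first exact/wsE.
  have F'C j : F' (at_pos (repr C) j) by have [] := boundary_cycle_face j bF'.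
  have [F'v F'a F'b] : [/\ F' v, F' a & F' b].
    by case: Ci => -[<- <- <-]; split; apply: F'C.
  by rewrite (two_face_unique polytopeP simpleP kF kF' va vb ab).
move=> F G C /fsE kF /fsE kG /wsE WC bF bG.
have [en ep pn] := walk_edges 0 (facoidal_walk WC).
have FC j : F (at_pos (repr C) j) by have [] := boundary_cycle_face j bF.
have GC j : G (at_pos (repr C) j) by have [] := boundary_cycle_face j bG.
by apply: (two_face_unique polytopeP simpleP kF kG ep en pn);
  do ?[exact: FC|exact: GC].
Qed.

End FacoidalSystems.

Theorem theorem4 (R : realType) (n d : nat) (P : set 'rV[R]_n)
    (W : set (cyc_seq 'rV[R]_n)) (O : rel 'rV[R]_n)
    (polytopeP : polytope P) (simpleP : simple P d) (facoidalW : facoidal P W)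
    (orientationO : orientation P O) (acyclicO : acyclic O) :
  [/\ (ncard W <= f_ 2 P <= H2 P d O)%N,
      ncard W = f_ 2 P <-> W = F2 P &
      f_ 2 P = H2 P d O <-> AOF_orientation P O].
Proof.
have [f2_le f2_eq] := f2_H2 polytopeP simpleP orientationO acyclicO.
(* One generic functional suffices for the inequality; the equality case uses a functional adapted
   to each 2-face. *)
have [h hsep] := separating_functional polytopeP.
have [W_le _] := facoidal_sinks polytopeP simpleP facoidalW hsep.
split; first by rewrite W_le f2_le.
  split; first exact (facoidal_F2 polytopeP simpleP facoidalW).
  move=> /(F2_facoidal_card polytopeP simpleP facoidalW) le_W.
  by apply/eqP; rewrite eqn_leq W_le le_W.
exact: f2_eq.
Qed.
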